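(* If $C^e\in\mathcal{S}$ (the distribution of $C^e$ is subexponential), then the absolute relative error of the corrected replace approximation satisfies $$|R_{r,\epsilon}(u)|=\left|1-\frac{\tilde\psi_{r,\epsilon}(u)}{\psi_\epsilon(u)}\right|\;\longrightarrow\;\left|\frac{\epsilon(\theta-\delta)}{1-\delta}\right|\qquad\text{as }u\to\infty,$$ and it goes asymptotically to zero (as $u\to\infty$) when $\mathbb{E}B=\mathbb{E}C$.
   Context: Fix $\lambda>0$ and $\epsilon\in[0,1]$. Let $B$ be a nonnegative random variable with a phase-type distribution and $C$ a nonnegative random variable with a heavy-tailed distribution ($\mathbb{E}e^{rC}=\infty$ for all $r>0$), both with finite positive means. Classical Cramér–Lundberg model: premiums flow in at rate 1, claims arrive according to a Poisson process $\{N_\epsilon(t)\}$ of rate $\lambda$, and the claim sizes $U_{\epsilon,i}$ are i.i.d., independent of $N_\epsilon$, distributed as $B$ with probability $1-\epsilon$ and as $C$ with probability $\epsilon$. Let $M_\epsilon=\sup_{t\ge0}\big(\sum_{i=1}^{N_\epsilon(t)}U_{\epsilon,i}-t\big)$ and let $\psi_\epsilon(u)=\mathbb{P}(M_\epsilon>u)$ be the ruin probability with initial capital $u\ge0$. Put $\delta=\lambda\mathbb{E}B$, $\theta=\lambda\mathbb{E}C$, $\rho_\epsilon=(1-\epsilon)\delta+\epsilon\theta$. Standing assumptions: $\rho_\epsilon<1$ and $\delta<1$. For a nonnegative random variable with distribution $F$ and mean $\mu_F\in(0,\infty)$, its stationary excess distribution is $F^e(u)=\frac1{\mu_F}\int_0^u(1-F(t))\,dt$;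 $B^e$, $C^e$ have the stationary excess distributions of $B$, $C$. Replace base model: $M_0$ and $\psi_0(u)=\mathbb{P}(M_0>u)$ are $M_\epsilon$ and $\psi_\epsilon$ for $\epsilon=0$. The $M_{0,i}$, $C^e_1$, $B^e_1$ are copies of $M_0$, $C^e$, $B^e$ respectively, all mutually independent. Corrected replace approximation: \begin{align*} \tilde\psi_{r,\epsilon}(u)=\psi_0(u)&+\frac{\epsilon\theta}{1-\delta}\big(\mathbb{P}(M_{0,0}+M_{0,1}+C^e_1>u)-\mathbb{P}(M_{0,0}>u)\big)\\ &-\frac{\epsilon\delta}{1-\delta}\big(\mathbb{P}(M_{0,0}+M_{0,1}+B^e_1>u)-\mathbb{P}(M_{0,0}>u)\big). \end{align*} A distribution $F$ on $[0,\infty)$ belongs to the class $\mathcal{S}$ of subexponential distributions iff $\lim_{u\to\infty}\frac{1-F^{*n}(u)}{1-F(u)}=n$ for $n=1,2,\dots$, where $F^{*n}$ is the $n$-fold convolution. *)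

(* Defs.v *)
From HB Require Import structures.
From mathcomp Require Export all_boot all_order all_algebra.
From mathcomp Require Export all_classical all_reals all_analysis
  measurable_realfun.

Set Implicit Arguments.
Unset Strict Implicit.
Unset Printing Implicit Defensive.

Export Order.TTheory GRing.Theory Num.Theory.
Export numFieldNormedType.Exports.

Global Open Scope classical_set_scope.
Global Open Scope ring_scope.

Definition sigma_rv {d d'} {T : measurableType d} {T' : measurableType d'}
    (X : T -> T') : set_system T :=
  preimage_set_system [set: T] X measurable.

Definition sigma_process {d d'} {T : measurableType d} {T' : measurableType d'}
    {I : Type} (J : set I) (X : I -> T -> T') : set_system T :=
  <<s \bigcup_(i in J) sigma_rv (X i) >>.

Definition independent {d} {T : measurableType d} {R : realType}
    (P : probability T R) (F G : set_system T) : Prop :=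
  forall A B, F A -> G B -> P (A `&` B) = (P A * P B)%E.

Definition mutually_independent {d} {T : measurableType d} {R : realType}
    (P : probability T R) {I : eqType} (F : I -> set_system T) : Prop :=
  forall (J : seq I) (E : I -> set T), uniq J ->
    (forall i, i \in J -> F i (E i)) ->
    P (\bigcap_(i in [set` J]) E i) = (\prod_(i <- J) P (E i))%E.

Definition same_law {d1 d2 d'} {T1 : measurableType d1} {T2 : measurableType d2}
    {T' : measurableType d'} {R : realType} (P1 : probability T1 R)
    (P2 : probability T2 R) (X : T1 -> T') (Y : T2 -> T') : Prop :=
  forall A, measurable A -> P1 (X @^-1` A) = P2 (Y @^-1` A).

(* Time-homogeneous Markov transition matrices.  As the state space is finite,
   the continuity at 0 amounts to [p t = exp (t Q)] for an intensity matrix Q. *)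
Definition markov_transition {R : realType} {m : nat}
    (p : R -> 'M[R]_m) : Prop :=
  [/\ forall (t : R) i j, 0 <= t -> 0 <= p t i j,
      forall (t : R) i, 0 <= t -> \sum_j p t i j = 1,
      p 0 = 1%:M,
      forall s t : R, 0 <= s -> 0 <= t -> p (s + t) = p s *m p t
    & forall i j, p t i j @[t --> 0^'+] --> ((i == j)%:R : R)].

(* A right-continuous Markov jump process; the finite-dimensional laws are
   P(X_(t_0) = x_0, ..., X_(t_n) = x_n)
     = P(X_0 = x_0) * \prod_k p_(t_(k+1) - t_k)(x_k, x_(k+1)), with t_0 = 0. *)
Definition markov_jump_process {d} {T : measurableType d} {R : realType}
    (P : probability T R) {m : nat} (p : R -> 'M[R]_m)
    (X : R -> T -> 'I_m) : Prop :=
  [/\ forall (t : R) i, 0 <= t -> measurable (X t @^-1` [set i]),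
      forall w (t : R), 0 <= t -> \forall s \near t^'+, X s w = X t w
    & forall (n : nat) (t : nat -> R) (x : nat -> 'I_m), t 0%N = 0 ->
        (forall k, (k < n)%N -> t k <= t k.+1) ->
        P [set w | forall k, (k <= n)%N -> X (t k) w = x k] =
        (P (X 0%R @^-1` [set x 0%N]) *
         (\prod_(k < n) p (t k.+1 - t k) (x k) (x k.+1))%:E)%E].

(* The law of the absorption time of a Markov jump process with a finite number
   m of transient states and one absorbing state, [ord_max]; absorption is
   certain from every state.  The initial law may charge [ord_max]. *)
Definition phase_type {d} {T : measurableType d} {R : realType}
    (P : probability T R) (B : T -> R) : Prop :=
  exists (m : nat) (d' : measure_display) (T' : measurableType d')
    (P' : probability T' R) (p : R -> 'M[R]_m.+1)
    (X : R -> T' -> 'I_m.+1) (tau : {RV P' >-> R}),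
    [/\ markov_transition p,
        (forall t : R, 0 <= t -> p t ord_max ord_max = 1) /\
        (forall i, p t i ord_max @[t --> +oo] --> (1 : R)),
        markov_jump_process P' p X,
        {ae P', forall w, (tau w)%:E =
           ereal_inf [set t%:E | t in [set t : R | 0 <= t /\ X t w = ord_max]]}
      & same_law P P' B tau].

Definition heavy_tailed {d} {T : measurableType d} {R : realType}
    (P : probability T R) (C : T -> R) : Prop :=
  forall r : R, 0 < r -> 'M_P C r = +oo%E.

(* Counting process of a renewal sequence with exponential interarrival times:
   the (n+1)-st arrival occurs at time W_0 + ... + W_n. *)
Definition poisson_process {d} {T : measurableType d} {R : realType}
    (P : probability T R) (lambda : R) (N : R -> T -> nat) : Prop :=
  exists W : nat -> {RV P >-> R},
    [/\ mutually_independent P (fun k => sigma_rv (W k)),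
        forall k A, measurable A -> P (W k @^-1` A) = exponential_prob lambda A
      & forall (t : R) w n, 0 <= t ->
          (n <= N t w)%N = (\sum_(k < n) W k w <= t)].

Definition risk_model {d} {T : measurableType d} {R : realType}
    (P : probability T R) (lambda eps : R) (B C : T -> R)
    (N : R -> T -> nat) (U : nat -> {RV P >-> R}) : Prop :=
  [/\ poisson_process P lambda N,
      mutually_independent P (fun i => sigma_rv (U i)),
      forall i A, measurable A ->
        P (U i @^-1` A) =
        ((1 - eps)%:E * P (B @^-1` A) + eps%:E * P (C @^-1` A))%E
    & independent P (sigma_process `[0, +oo[ N)
                    (sigma_process [set: nat] U)].

Definition max_loss {T : Type} {R : realType} (N : R -> T -> nat)
    (U : nat -> T -> R) (w : T) : \bar R :=
  ereal_sup [set (\sum_(i < N t w) U i w - t)%:E | t in `[0, +oo[].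

Definition ruin_prob {d} {T : measurableType d} {R : realType}
    (P : probability T R) (M : T -> \bar R) (u : R) : R :=
  fine (P [set w | (u%:E < M w)%E]).

Definition stationary_excess {d} {T : measurableType d} {R : realType}
    (P : probability T R) (X Xe : {RV P >-> R}) : Prop :=
  forall u : R, 0 <= u -> fine (cdf Xe u) =
    (fine ('E_P[X])%E)^-1 *
    \int[lebesgue_measure]_(t in `[0, u]) (1 - fine (cdf X t)).

(* F^{*0} is the unit mass at 0 and F^{*(n+1)}(u) = \int F^{*n}(u - x) dF(x). *)
Fixpoint conv_cdf {R : realType} (F : probability R R) (n : nat) (u : R) : R :=
  if n is n'.+1 then \int[F]_(x in [set: R]) conv_cdf F n' (u - x)
  else (0 <= u)%R%:R.

Definition subexponential {R : realType} (F : probability R R) : Prop :=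
  F [set x | x < 0] = 0%E /\
  forall n : nat, (0 < n)%N ->
    (1 - conv_cdf F n u) / (1 - fine (F [set x | x <= u])) @[u --> +oo] -->
    (n%:R : R).

Definition corrected_replace {d} {T : measurableType d} {R : realType}
    (P : probability T R) (eps delta theta : R) (M0 M00 M01 : T -> \bar R)
    (Ce Be : T -> R) (u : R) : R :=
  ruin_prob P M0 u
  + eps * theta / (1 - delta) *
    (fine (P [set w | (u%:E < M00 w + M01 w + (Ce w)%:E)%E])
     - fine (P [set w | (u%:E < M00 w)%E]))
  - eps * delta / (1 - delta) *
    (fine (P [set w | (u%:E < M00 w + M01 w + (Be w)%:E)%E])
     - fine (P [set w | (u%:E < M00 w)%E])).

(* Main.v *)
(* Write [S] and [L] for the laws of C^e and B^e, a = (1 - epsilon) delta and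
   b = epsilon theta.  Finite-horizon maxima of the claim surplus walk obey
   Lindley's recursion V' = (V + U - W)^+ with independent V, U and W.  For an
   exponential W this turns, in the limit of an infinite horizon, into the
   defective renewal equation psi = a L * psi + b S * psi on [0, +oo), where psi
   is extended by 1 to the negative half-line.
   If S is subexponential and the tails of Q and f are asymptotically c_Q and c_f
   times the tail of S, then the tail of Q * f is asymptotically c_Q + c_f times
   it.  The tail of L is negligible, being geometrically small by the phase-type
   assumption.  Iterating the renewal equation, which is a contraction in a norm
   weighted by the tail of S, gives psi(u) ~ b / (1 - a - b) P(C^e > u).  Hence
   psi_0 is negligible, the approximation is equivalent to
   epsilon theta / (1 - delta) P(C^e > u), and the error follows by division.
   For epsilon = 0 the approximation is exact, as solutions of the renewal
   equation are unique, and positive. *)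

From HB Require Import structures.
Require Import Defs.
From mathcomp Require Import lra ring.

Set Implicit Arguments.
Unset Strict Implicit.
Unset Printing Implicit Defensive.

(** * Bounded measurable functions and convolution *)

(** The renewal equation comes from testing Lindley's recursion against
    [1_{u < v} + lambda (u - v)^+]. Averaging this function over an exponential waiting time of rate
    lambda, from the level z reached after a claim, leaves P(V' > 0 | z) + lambda (u - z)^+: the
    rest of the dependence on u cancels. The claim law then enters only through lambda E min(U, x),
    an integrated tail and hence a mixture of the laws of B^e and C^e. The expected gap is monotone
    in the horizon, so its increments vanish in the limit. Three obstacles shape the rest. The
    independence hypothesis speaks of the counting process and not of the waiting times, which have
    to be recovered from it up to a null set. A uniform error bound on the iterates of the renewal
    equation says nothing after division by a vanishing tail, whence the weighted norm. And at
    epsilon = 0 the leading constant epsilon theta / (1 - rho) vanishes, so that the quotient of the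
    two asymptotics is meaningless there. *)

Lemma measurable_preimage d1 d2 (T1 : measurableType d1)
    (T2 : measurableType d2) (X : T1 -> T2) (A : set T2) :
  measurable_fun setT X -> measurable A -> measurable (X @^-1` A).
Proof. by move=> mX mA; have := mX measurableT _ mA; rewrite setTI. Qed.

Section bounded_measurable.
Context {d} {T : measurableType d} {R : realType}.
Implicit Types f g : T -> R.

Definition bounded_meas f :=
  measurable_fun [set: T] f /\ exists K, forall x, `|f x| <= K.

Lemma bounded_meas_integrable (P : probability T R) f :
  bounded_meas f -> P.-integrable [set: T] (EFin \o f).
Proof.
move=> [mf [K fK]]; apply: measurable_bounded_integrable => //.
  by apply: le_lt_trans (probability_le1 P measurableT) _; rewrite ltry.
exists K; split; first exact: num_real.
by move=> r Kr x _ /=; rewrite (le_trans (fK x))// ltW.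
Qed.

Lemma bounded_meas_cst c : bounded_meas (fun=> c).
Proof. by split; [exact: measurable_cst|exists `|c|]. Qed.

Lemma bounded_measD f g : bounded_meas f -> bounded_meas g ->
  bounded_meas (fun x => f x + g x).
Proof.
move=> [mf [K fK]] [mg [L gL]]; split; first exact: measurable_funD.
by exists (K + L) => x; rewrite (le_trans (ler_normD _ _))// lerD.
Qed.

Lemma bounded_measM f g : bounded_meas f -> bounded_meas g ->
  bounded_meas (fun x => f x * g x).
Proof.
move=> [mf [K fK]] [mg [L gL]]; split; first exact: measurable_funM.
by exists (K * L) => x; rewrite normrM ler_pM.
Qed.

Lemma bounded_measZ c f : bounded_meas f -> bounded_meas (fun x => c * f x).
Proof. by move=> bf; apply: bounded_measM => //; exact: bounded_meas_cst. Qed.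

Lemma bounded_measB f g : bounded_meas f -> bounded_meas g ->
  bounded_meas (fun x => f x - g x).
Proof.
move=> bf [mg [L gL]]; apply: bounded_measD => //; split.
  exact: measurable_funN.
by exists L => x; rewrite normrN.
Qed.

Lemma bounded_meas_indic (D : set T) : measurable D -> bounded_meas (\1_D : T -> R).
Proof.
move=> mD; split; first exact: measurable_indic.
by exists 1 => x; rewrite indicE; case: (_ \in _); rewrite ?normr1 ?normr0.
Qed.

Lemma bounded_meas_ge0 f K : measurable_fun setT f ->
  (forall x, 0 <= f x <= K) -> bounded_meas f.
Proof.
move=> mf fK; split=> //; exists K => x.
by have /andP[f0 f1] := fK x; rewrite ger0_norm.
Qed.

Lemma EFin_Rintegral (P : probability T R) f : bounded_meas f ->
  (\int[P]_x f x)%:E = (\int[P]_x (f x)%:E)%E.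
Proof.
move=> bf; rewrite /Rintegral fineK//.
by apply: integrable_fin_num => //; exact: bounded_meas_integrable.
Qed.

End bounded_measurable.

Lemma fine_probability_le d (T : measurableType d) (R : realType)
    (P : probability T R) (A B : set T) :
  measurable A -> measurable B -> A `<=` B -> fine (P A) <= fine (P B).
Proof. by move=> mA mB AB; rewrite fine_le ?fin_num_measure// le_measure ?inE. Qed.

Section convolution.
Context {R : realType}.
Implicit Types (Q S : probability R R) (f g : R -> R).

Definition convolve Q f (u : R) : R := \int[Q]_x f (u - x).

Definition survival Q (u : R) : R := fine (Q [set x | u < x]).

Lemma measurable_ray_lt (a : R) : measurable [set x : R | x < a].
Proof. by rewrite -set_itvNyo. Qed.

Lemma measurable_ray_le (a : R) : measurable [set x : R | x <= a].
Proof. by rewrite -set_itvNyc. Qed.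

Lemma measurable_ray_gt (a : R) : measurable [set x : R | a < x].
Proof. by rewrite -set_itvoy. Qed.

Lemma measurable_ray_ge (a : R) : measurable [set x : R | a <= x].
Proof. by rewrite -set_itvcy. Qed.


Lemma indic_ray_lt (a v : R) : (\1_[set x : R | x < a] : R -> R) v = (v < a)%R%:R.
Proof. by rewrite indicE; congr ((nat_of_bool _)%:R); apply/idP/idP; rewrite inE. Qed.

Lemma indic_ray_le (a v : R) : (\1_[set x : R | x <= a] : R -> R) v = (v <= a)%R%:R.
Proof. by rewrite indicE; congr ((nat_of_bool _)%:R); apply/idP/idP; rewrite inE. Qed.

Lemma indic_ray_ge (a v : R) : (\1_[set x : R | a <= x] : R -> R) v = (a <= v)%R%:R.
Proof. by rewrite indicE; congr ((nat_of_bool _)%:R); apply/idP/idP; rewrite inE. Qed.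

Lemma bounded_meas_reflect f (u : R) :
  bounded_meas f -> bounded_meas (fun x : R => f (u - x)).
Proof.
move=> [mf [K fK]]; split; last by exists K.
by apply: measurableT_comp => //; exact: measurable_funB.
Qed.

Lemma bounded_meas_nonincr f : {homo f : x y /~ x <= y} ->
  (forall x, 0 <= f x <= 1) -> bounded_meas f.
Proof.
move=> nf f01; split; first by apply: nonincreasing_measurable => // x y /nf.
by exists 1 => x; have /andP[f0 f1] := f01 x; rewrite ger0_norm.
Qed.

Lemma convD Q f g u : bounded_meas f -> bounded_meas g ->
  convolve Q (fun x => f x + g x) u = convolve Q f u + convolve Q g u.
Proof.
move=> bf bg; rewrite /convolve RintegralD//.
- exact/bounded_meas_integrable/bounded_meas_reflect.
- exact/bounded_meas_integrable/bounded_meas_reflect.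
Qed.

Lemma convB Q f g u : bounded_meas f -> bounded_meas g ->
  convolve Q (fun x => f x - g x) u = convolve Q f u - convolve Q g u.
Proof.
move=> bf bg; rewrite /convolve RintegralB//.
- exact/bounded_meas_integrable/bounded_meas_reflect.
- exact/bounded_meas_integrable/bounded_meas_reflect.
Qed.

Lemma convZ Q c f u : bounded_meas f ->
  convolve Q (fun x => c * f x) u = c * convolve Q f u.
Proof.
move=> bf; rewrite /convolve RintegralZl//.
exact/bounded_meas_integrable/bounded_meas_reflect.
Qed.

Lemma conv_cst Q c u : convolve Q (fun=> c) u = c.
Proof.
by rewrite /convolve Rintegral_cst//= probability_setT mulr1.
Qed.

Lemma ler_conv Q f g u : bounded_meas f -> bounded_meas g ->
  (forall x, f x <= g x) -> convolve Q f u <= convolve Q g u.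
Proof.
move=> bf bg fg; apply: le_Rintegral => //.
- exact/bounded_meas_integrable/bounded_meas_reflect.
- exact/bounded_meas_integrable/bounded_meas_reflect.
Qed.

Lemma conv_ge0_le1 Q f u : bounded_meas f -> (forall x, 0 <= f x <= 1) ->
  0 <= convolve Q f u <= 1.
Proof.
move=> bf f01; apply/andP; split.
- by rewrite -(conv_cst Q 0 u) ler_conv//;
    [exact: bounded_meas_cst|move=> x; case/andP: (f01 x)].
- by rewrite -[leRHS](conv_cst Q 1 u) ler_conv//;
    [exact: bounded_meas_cst|move=> x; case/andP: (f01 x)].
Qed.

Lemma conv_indic Q (D : set R) u : measurable D ->
  convolve Q (\1_D) u = fine (Q [set x | D (u - x)]).
Proof.
move=> mD; rewrite /convolve /Rintegral; congr fine.
have mE : measurable [set x | D (u - x)].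
  have mu : measurable_fun [set: R] (fun x : R => u - x) by exact: measurable_funB.
  exact: (measurable_preimage mu mD).
transitivity (\int[Q]_x (\1_[set x | D (u - x)] x)%:E)%E.
  apply: eq_integral => x _; rewrite !indicE.
  by congr (_%:R%:E); apply/idP/idP; rewrite !inE.
by rewrite integral_indic// setIT.
Qed.

Lemma survival_ge0_le1 Q u : 0 <= survival Q u <= 1.
Proof.
rewrite /survival fine_ge0//= -[leRHS](_ : fine (1%E : \bar R) = _)//.
rewrite -(probability_setT Q) fine_probability_le//; exact: measurable_ray_gt.
Qed.

Lemma survival_ge0 Q u : 0 <= survival Q u.
Proof. by case/andP: (survival_ge0_le1 Q u). Qed.

Lemma survival_le1 Q u : survival Q u <= 1.
Proof. by case/andP: (survival_ge0_le1 Q u). Qed.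

Lemma survival_nonincr Q : {homo survival Q : x y /~ x <= y}.
Proof.
move=> x y xy; apply: fine_probability_le; try exact: measurable_ray_gt.
by move=> z /=; apply: le_lt_trans.
Qed.

Lemma bounded_meas_tail Q : bounded_meas (survival Q).
Proof.
by apply: bounded_meas_nonincr; [exact: survival_nonincr|exact: survival_ge0_le1].
Qed.

Lemma survival_cdf Q u : survival Q u = 1 - fine (Q [set x | x <= u]).
Proof.
have -> : survival Q u = fine (Q (~` [set x | x <= u])).
  rewrite /survival; congr (fine (Q _)).
  by rewrite predeqE => x /=; rewrite ltNge; split => [/negP|h]; [|apply/negP].
have m := measurable_ray_le u.
rewrite probability_setC//=.
by rewrite fineB// fin_num_measure.
Qed.

Lemma survival_lt0 Q u : Q [set x | x < 0] = 0%E -> u < 0 -> survival Q u = 1.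
Proof.
move=> Q0 u0; rewrite survival_cdf [X in fine X](_ : _ = 0%E) ?subr0//.
apply/eqP; rewrite eq_le measure_ge0 andbT -Q0 le_measure// ?inE//.
- exact: measurable_ray_le.
- exact: measurable_ray_lt.
- by move=> x /= /le_lt_trans; apply.
Qed.

(** Left rays serve as test functions throughout: a pointwise bound by their indicators becomes,
    after convolution, a bound by shifted tails. *)
Lemma conv_ray_lt Q a u : convolve Q (\1_[set x | x < a]) u = survival Q (u - a).
Proof.
rewrite conv_indic; last exact: measurable_ray_lt.
by congr (fine (Q _)); rewrite predeqE => x /=; split; lra.
Qed.

Lemma survival_cvg0 Q : survival Q u @[u --> +oo] --> (0 : R).
Proof.
(* The identity is a random variable on the line under Q, and its ccdf is [survival Q]. *)
pose i : R -> R := idfun.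
have mi : measurable_fun [set: R] i by exact: measurable_id.
pose X : {RV Q >-> R} := HB.pack i (isMeasurableFun.Build _ _ _ _ i mi).
have := @cvg_ccdfy0 _ _ _ Q X.
rewrite (_ : ccdf X = EFin \o survival Q).
  by move/fine_cvgP => [_].
by apply/funext => u; rewrite /ccdf /= /survival fineK -?set_itvoy ?fin_num_measure.
Qed.

End convolution.

(** * Subexponential laws *)

Section convolution_commutes.
Context {R : realType}.
Implicit Types (Q S L : probability R R) (f g : R -> R).

Lemma bounded_meas_conv Q f : bounded_meas f -> (forall x, 0 <= f x) ->
  bounded_meas (convolve Q f).
Proof.
move=> bf f0; have [mf [K fK]] := bf; split; last first.
  exists K => u; rewrite ger0_norm; last exact: Rintegral_ge0.
  rewrite -(conv_cst Q K u) ler_conv//; first exact: bounded_meas_cst.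
  by move=> x; rewrite (le_trans (ler_norm _)).
apply/measurable_EFinP.
rewrite [X in measurable_fun _ X](_ : _ =
    fubini_F Q (fun z : R * R => (f (z.1 - z.2))%:E)); last first.
  by apply/funext => u /=; rewrite EFin_Rintegral//; exact: bounded_meas_reflect.
apply: measurable_fun_fubini_tonelli_F => /=; last by move=> x; rewrite lee_fin.
apply/measurable_EFinP; apply: measurableT_comp => //.
exact: measurable_funB.
Qed.

Lemma convC Q S f u : bounded_meas f -> (forall x, 0 <= f x) ->
  convolve Q (convolve S f) u = convolve S (convolve Q f) u.
Proof.
move=> bf f0; apply: EFin_inj.
have E Q' S' : (convolve Q' (convolve S' f) u)%:E =
    (\int[Q']_x \int[S']_y (f (u - x - y))%:E)%E.
  rewrite EFin_Rintegral; last exact/bounded_meas_reflect/bounded_meas_conv.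
  by apply: eq_integral => x _; rewrite EFin_Rintegral//; exact: bounded_meas_reflect.
rewrite !E.
have [mf _] := bf.
rewrite (@fubini_tonelli _ _ _ _ _ Q S (fun z : R * R => (f (u - z.1 - z.2))%:E))/=.
- apply: eq_integral => y _; apply: eq_integral => x _ /=.
  by congr (f _)%:E; ring.
- apply/measurable_EFinP; apply: measurableT_comp => //.
  by apply: measurable_funB => //; exact: measurable_funB.
- by move=> x; rewrite lee_fin.
Qed.

(** Both sides are double convolutions of the indicator of the negative half-line. *)
Lemma conv_tailC Q S u : convolve Q (survival S) u = convolve S (survival Q) u.
Proof.
have E L : survival L = convolve L (\1_[set x | x < 0]).
  by apply/funext => v; rewrite conv_ray_lt subr0.
rewrite (E Q) (E S) convC//.
by apply: bounded_meas_indic; exact: measurable_ray_lt.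
Qed.

End convolution_commutes.

Section subexponential.
Context {R : realType}.
Variable S : probability R R.
Hypothesis Ssub : subexponential S.
Implicit Types (Q L : probability R R) (f g : R -> R).

Lemma subexp_lt0 : S [set x | x < 0] = 0%E. Proof. by case: Ssub. Qed.

(** The case n = 2 of the definition: since constants are fixed by convolution, 1 - F^{*2} is S
    convolved with its own tail. *)
Lemma subexp_conv_self : convolve S (survival S) u / survival S u @[u --> +oo] --> (2 : R).
Proof.
case: Ssub => _ /(_ 2%N isT); apply: cvg_trans; apply: near_eq_cvg.
near=> u; rewrite survival_cdf; congr (_ / _) => /=.
rewrite -[X in X - _](conv_cst S 1 u) -[X in _ - X]/(convolve S (conv_cdf S 1) u).
have E : conv_cdf S 1 = fun v => 1 - survival S v.
  apply/funext => v; rewrite survival_cdf opprB addrC subrK.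
  rewrite -[LHS]/(convolve S (conv_cdf S 0) v).
  rewrite [conv_cdf S 0](_ : _ = \1_[set x | 0 <= x]); last first.
    by apply/funext => x /=; rewrite indic_ray_ge.
  rewrite conv_indic; last exact: measurable_ray_ge.
  by congr (fine (S _)); rewrite predeqE => x /=; rewrite subr_ge0.
rewrite E -convB.
- by congr (convolve S _ u); apply/funext => v; ring.
- exact: bounded_meas_cst.
- by apply: bounded_measB; [exact: bounded_meas_cst|exact: bounded_meas_tail].
Unshelve. all: by end_near. Qed.

(** Where the tail vanishes, the quotient in [subexp_conv_self] is 0 by convention, which is
    incompatible with the limit 2; monotonicity carries positivity back to every u. *)
Lemma subexp_tail_gt0 u : 0 < survival S u.
Proof.
have : \forall v \near +oo, survival S v != 0.
  near=> v; have : 1 < convolve S (survival S) v / survival S v.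
    by near: v; exact: cvgr_gt _ subexp_conv_self _ (ltr1n R 2).
  by apply: contraTneq => ->; rewrite invr0 mulr0 ltr10.
move=> [M [_ HM]]; pose v := Num.max u (M + 1).
have : survival S v != 0 by apply: HM; rewrite /v lt_max ltrDl ltr01 orbT.
have := survival_ge0 S v; rewrite le0r => /orP[/eqP->/eqP//|v0 _].
by rewrite (lt_le_trans v0)// survival_nonincr// /v le_max lexx.
Unshelve. all: by end_near. Qed.

(** With s the tail of S, splitting P(X + Y > u) according to X > u, a < X <= u or X <= a gives the
    lower bound s(u) + s(u - a) (s(a) - s(u)) + s(u) (1 - s(a)). Division by s(u) bounds s(u - a) /
    s(u) above, and the limit 2 makes that bound tend to 1. *)
Lemma subexp_long_tailed (a : R) : 0 <= a ->
  survival S (u - a) / survival S u @[u --> +oo] --> (1 : R).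
Proof.
move=> a0.
have a0' := subexp_tail_gt0 a.
apply: (@squeeze_cvgr _ _ _ _ (fun=> 1)
  (fun u => (convolve S (survival S) u / survival S u - 2 + survival S a) /
            (survival S a - survival S u))).
- near=> u.
  have u0 := subexp_tail_gt0 u.
  have au : a < u by near: u; apply: nbhs_pinfty_gt; exact: num_real.
  have tau : survival S u < survival S a.
    by near: u; apply: cvgr_lt; [exact: survival_cvg0|exact: a0'].
  rewrite ler_pdivlMr// mul1r survival_nonincr ?gerBl//=.
  rewrite ler_pdivlMr ?subr_gt0// mulrAC ler_pdivrMr//.
  rewrite 2!mulrDl divfK ?gt_eqF// mulNr.
  pose i0 : R -> R := \1_[set x | x < 0].
  pose i1 : R -> R := \1_[set x | x < u - a].
  pose i2 : R -> R := \1_[set x | x <= u].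
  have b0 : bounded_meas i0 by apply: bounded_meas_indic; exact: measurable_ray_lt.
  have b1 : bounded_meas i1 by apply: bounded_meas_indic; exact: measurable_ray_lt.
  have b2 : bounded_meas i2 by apply: bounded_meas_indic; exact: measurable_ray_le.
  have c2 : convolve S i2 u = 1.
    rewrite conv_indic; last exact: measurable_ray_le.
    rewrite [X in S X](_ : _ = ~` [set x | x < 0]); last first.
      rewrite predeqE => x /=; rewrite gerBl leNgt; split => [/negP|h]//.
      by apply/negP.
    rewrite probability_setC ?subexp_lt0 ?sube0//; exact: measurable_ray_lt.
  (* A step function below the tail in the variable v = u - x; its three pieces are x > u, 0 <= x <=
     a and a < x <= u. *)
  have hle : forall v, i0 v + (survival S u * (i2 v - i1 v) +
       survival S (u - a) * (i1 v - i0 v)) <= survival S v.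
    move=> v; rewrite /i0 /i1 /i2 !indic_ray_lt indic_ray_le.
    have [v0|v0] := ltP v 0.
      have -> : v < u - a by lra.
      have -> : v <= u by lra.
      rewrite (survival_lt0 subexp_lt0 v0) /=; lra.
    have [v1|v1] := ltP v (u - a).
      have -> : v <= u by lra.
      have := survival_nonincr S (ltW v1); rewrite /=; lra.
    have [v2|v2] := leP v u; last by have := survival_ge0 S v; rewrite /=; lra.
    have := survival_nonincr S v2; rewrite /=; lra.
  have bb2 : bounded_meas (fun v => survival S u * (i2 v - i1 v)).
    exact/bounded_measZ/bounded_measB.
  have bb1 : bounded_meas (fun v => survival S (u - a) * (i1 v - i0 v)).
    exact/bounded_measZ/bounded_measB.
  have bs : bounded_meas (fun v => i0 v + (survival S u * (i2 v - i1 v) +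
       survival S (u - a) * (i1 v - i0 v))).
    by apply: bounded_measD => //; exact: bounded_measD.
  have := ler_conv S u bs (bounded_meas_tail S) hle.
  rewrite !convD// ?convZ ?convB//; try exact: bounded_measB.
    rewrite c2 /i0 /i1 !conv_ray_lt subr0 subKr.
    rewrite -subr_ge0 => H; rewrite -subr_ge0.
    by rewrite (le_trans H)// le_eqVlt; apply/orP; left; apply/eqP; ring.
  by apply: bounded_measD.
- exact: cvg_cst.
- have a0n : survival S a != 0 by rewrite gt_eqF.
  rewrite -[X in _ --> X](divff a0n); apply: cvgM.
    rewrite [X in _ --> X](_ : _ = 2 - 2 + survival S a); last by ring.
    by apply: cvgD; [apply: cvgB; [exact: subexp_conv_self|]|]; exact: cvg_cst.
  apply: cvgV => //; rewrite -[X in _ --> X]subr0.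
  by apply: cvgB; [exact: cvg_cst|exact: survival_cvg0].
Unshelve. all: by end_near. Qed.
End subexponential.

Section closure.
Context {R : realType}.
Variable S : probability R R.
Hypothesis Ssub : subexponential S.
Implicit Types (Q L : probability R R) (f g : R -> R).

Lemma survival_shift_ratio f (c a : R) : 0 <= a ->
  f u / survival S u @[u --> +oo] --> c -> f (u - a) / survival S u @[u --> +oo] --> c.
Proof.
move=> a0 fc.
have shift : (fun u : R => u - a) @ +oo --> +oo.
  apply/cvgryPge => A; near=> u; rewrite lerBrDr; near: u.
  by apply: nbhs_pinfty_ge; exact: num_real.
rewrite -[c]mulr1.
apply: cvg_trans (cvgM (cvg_comp _ _ shift fc) (subexp_long_tailed Ssub a0)).
apply: near_eq_cvg; near=> u => /=.
have := subexp_tail_gt0 Ssub (u - a); have := subexp_tail_gt0 Ssub u => s1 s2.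
by field; rewrite !gt_eqF.
Unshelve. all: by end_near. Qed.

(** Beyond some a, f lies between two multiples of [survival S], whose convolution with Q is known
    by hypothesis. On [0, a) nothing is known beyond 0 <= f <= 1, but this range is seen by Q only
    through its mass near u, and [survival_shift_ratio] makes the tails of Q at u and u - a
    equivalent on the scale of [survival S]. *)
Lemma conv_ratio_of Q f (cQ cf : R) :
  survival Q u / survival S u @[u --> +oo] --> cQ ->
  convolve Q (survival S) u / survival S u @[u --> +oo] --> 1 + cQ ->
  measurable_fun [set: R] f -> (forall u, 0 <= f u <= 1) ->
  (forall u, u < 0 -> f u = 1) ->
  f u / survival S u @[u --> +oo] --> cf ->
  convolve Q f u / survival S u @[u --> +oo] --> cf + cQ.
Proof.
move=> HQ HQS mf f01 fneg Hf.
have bf : bounded_meas f by exact: bounded_meas_ge0 f01.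
have bS := bounded_meas_tail S.
have biv (a : R) : bounded_meas (\1_[set x : R | x < a] : R -> R).
  by apply: bounded_meas_indic; exact: measurable_ray_lt.
apply/cvgrPdist_le => e e0.
have e20 : 0 < e / 2 by lra.
have /cvgrPdist_le/(_ _ e20) [M [_ HM]] := Hf.
pose a := Num.max 0 (M + 1).
have a0 : 0 <= a by rewrite le_max lexx.
(* Cutting [cm] at 0 makes [lo] nonpositive on [0, a), hence below f there. *)
pose cp := cf + e / 2; pose cm := Num.max 0 (cf - e / 2).
have cm0 : 0 <= cm by rewrite le_max lexx.
have cf0 : 0 <= cf.
  apply: (cvgr_to_ge Hf); near=> u; rewrite divr_ge0 ?survival_ge0//.
  by case/andP: (f01 u).
have cp0 : 0 <= cp by rewrite /cp; lra.
have fa v : a <= v -> cm * survival S v <= f v <= cp * survival S v.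
  rewrite ge_max => /andP[v0 Mv]; have s0 := subexp_tail_gt0 Ssub v.
  have /andP[fv0 _] := f01 v.
  have : `|cf - f v / survival S v| <= e / 2 by apply: HM; lra.
  rewrite ler_norml => /andP[h1 h2]; apply/andP; split.
    rewrite -ler_pdivlMr// ge_max divr_ge0 ?survival_ge0//=; lra.
  by rewrite -ler_pdivrMr// /cp; lra.
pose lo v : R := cm * (survival S v - \1_[set x | x < a] v) + \1_[set x | x < 0] v.
pose hi v : R := cp * (survival S v - \1_[set x | x < 0] v) + \1_[set x | x < a] v.
have bS1 (b : R) :
    bounded_meas (fun v => survival S v - (\1_[set x : R | x < b] : R -> R) v).
  exact: bounded_measB.
have blo : bounded_meas lo by apply: bounded_measD => //; exact: bounded_measZ.
have bhi : bounded_meas hi by apply: bounded_measD => //; exact: bounded_measZ.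
have lof v : lo v <= f v.
  rewrite /lo !indic_ray_lt; have /andP[f0 f1] := f01 v.
  have [v0|v0] := ltP v 0.
    have -> : v < a by lra.
    by rewrite (survival_lt0 (subexp_lt0 Ssub) v0) fneg//= subrr mulr0 add0r.
  have [va|va] /= := ltP v a.
    rewrite addr0 (le_trans _ f0)// mulr_ge0_le0// subr_le0; exact: survival_le1.
  by rewrite subr0 addr0; have /andP[] := fa v va.
have fhi v : f v <= hi v.
  rewrite /hi !indic_ray_lt; have /andP[f0 f1] := f01 v.
  have [v0|v0] := ltP v 0.
    have -> : v < a by lra.
    by rewrite (survival_lt0 (subexp_lt0 Ssub) v0) fneg//= subrr mulr0 add0r.
  have [va|va] /= := ltP v a.
    rewrite subr0 (le_trans f1)// lerDr mulr_ge0//; exact: survival_ge0.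
  by rewrite subr0 addr0; have /andP[] := fa v va.
have convlo u : convolve Q lo u =
    cm * (convolve Q (survival S) u - survival Q (u - a)) + survival Q u.
  rewrite /lo convD//; last exact: bounded_measZ.
  by rewrite convZ// convB// !conv_ray_lt subr0.
have convhi u : convolve Q hi u =
    cp * (convolve Q (survival S) u - survival Q u) + survival Q (u - a).
  rewrite /hi convD//; last exact: bounded_measZ.
  by rewrite convZ// convB// !conv_ray_lt subr0.
have Qa := survival_shift_ratio a0 HQ.
have limlo : convolve Q lo u / survival S u @[u --> +oo] --> cm + cQ.
  rewrite -[X in X + _]mulr1 -[X in _ * X](addrK cQ).
  apply: cvg_trans (cvgD (cvgM (cvg_cst cm) (cvgB HQS Qa)) HQ).
  by apply: near_eq_cvg; near=> u; rewrite /= convlo !fctE/=; ring.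
have limhi : convolve Q hi u / survival S u @[u --> +oo] --> cp + cQ.
  rewrite -[X in X + _]mulr1 -[X in _ * X](addrK cQ).
  apply: cvg_trans (cvgD (cvgM (cvg_cst cp) (cvgB HQS HQ)) Qa).
  by apply: near_eq_cvg; near=> u; rewrite /= convhi !fctE/=; ring.
near=> u.
have s0 := subexp_tail_gt0 Ssub u.
have h1 : convolve Q lo u / survival S u <= convolve Q f u / survival S u.
  by rewrite ler_pM2r ?invr_gt0// ler_conv.
have h2 : convolve Q f u / survival S u <= convolve Q hi u / survival S u.
  by rewrite ler_pM2r ?invr_gt0// ler_conv.
have h3 : `|cm + cQ - convolve Q lo u / survival S u| <= e / 2.
  by near: u; move/cvgrPdist_le : limlo; apply.
have h4 : `|cp + cQ - convolve Q hi u / survival S u| <= e / 2.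
  by near: u; move/cvgrPdist_le : limhi; apply.
have cmle : cf - e / 2 <= cm by rewrite le_max lexx orbT.
move: h3 h4; rewrite !ler_norml => /andP[h31 h32] /andP[h41 h42].
rewrite /cp in h41 h42.
by apply/andP; split; lra.
Unshelve. all: by end_near. Qed.

Lemma survival_ratio_self : survival S u / survival S u @[u --> +oo] --> (1 : R).
Proof.
apply: (@cvg_trans _ ((fun=> 1 : R) @ +oo)); last exact: cvg_cst.
apply: near_eq_cvg; near=> u.
by rewrite divff// gt_eqF// subexp_tail_gt0.
Unshelve. all: by end_near. Qed.

(* [conv_ratio_of] with [S] in place of [Q] and [survival Q] in place of [f], where
   its hypothesis on [convolve S (survival S)] is subexponentiality itself. *)
Lemma conv_tail_ratio Q (cQ : R) : Q [set x | x < 0] = 0%E ->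
  survival Q u / survival S u @[u --> +oo] --> cQ ->
  convolve Q (survival S) u / survival S u @[u --> +oo] --> 1 + cQ.
Proof.
move=> Q0 HQ.
have [mQ _] := bounded_meas_tail Q.
have := conv_ratio_of survival_ratio_self (subexp_conv_self Ssub) mQ (survival_ge0_le1 Q)
  (fun u => survival_lt0 Q0) HQ.
rewrite addrC; apply: cvg_trans; apply: near_eq_cvg; near=> u.
by rewrite conv_tailC.
Unshelve. all: by end_near. Qed.

Lemma conv_ratio Q f (cQ cf : R) : Q [set x | x < 0] = 0%E ->
  survival Q u / survival S u @[u --> +oo] --> cQ ->
  measurable_fun [set: R] f -> (forall u, 0 <= f u <= 1) ->
  (forall u, u < 0 -> f u = 1) ->
  f u / survival S u @[u --> +oo] --> cf ->
  convolve Q f u / survival S u @[u --> +oo] --> cf + cQ.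
Proof. by move=> Q0 HQ; apply: conv_ratio_of => //; exact: conv_tail_ratio. Qed.

End closure.

(** * The renewal equation *)

Section renewal.
Context {R : realType}.
Variables (L S : probability R R) (a b : R).
Hypotheses (a0 : 0 <= a) (b0 : 0 <= b) (ab1 : a + b < 1).
Implicit Types (f g h : R -> R).

Definition mixconv f (u : R) : R := a * convolve L f u + b * convolve S f u.

(** The value 1 on the negative half-line makes [convolve Q f u] contain the mass of Q beyond u. The
    inhomogeneous term of the renewal equation is thus part of the convolution. *)
Definition unit_fun f := [/\ measurable_fun [set: R] f,
  forall u, 0 <= f u <= 1 & forall u, u < 0 -> f u = 1].

Lemma unit_fun_bounded f : unit_fun f -> bounded_meas f.
Proof. by case=> mf f01 _; exact: bounded_meas_ge0 f01. Qed.

Lemma ler_mixconv f g u : bounded_meas f -> bounded_meas g ->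
  (forall x, f x <= g x) -> mixconv f u <= mixconv g u.
Proof.
by move=> bf bg fg; rewrite lerD// ler_wpM2l//; exact: ler_conv.
Qed.

Lemma mixconvB f g u : bounded_meas f -> bounded_meas g ->
  mixconv (fun x => f x - g x) u = mixconv f u - mixconv g u.
Proof. by move=> bf bg; rewrite /mixconv !convB//; ring. Qed.

Lemma mixconvD f g u : bounded_meas f -> bounded_meas g ->
  mixconv (fun x => f x + g x) u = mixconv f u + mixconv g u.
Proof. by move=> bf bg; rewrite /mixconv !convD//; ring. Qed.

Lemma mixconvZ c f u : bounded_meas f ->
  mixconv (fun x => c * f x) u = c * mixconv f u.
Proof. by move=> bf; rewrite /mixconv !convZ//; ring. Qed.

Lemma mixconv_cst c u : mixconv (fun=> c) u = (a + b) * c.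
Proof. by rewrite /mixconv !conv_cst; ring. Qed.

Lemma mixconv_ray u :
  mixconv (\1_[set x | x < 0]) u = a * survival L u + b * survival S u.
Proof. by rewrite /mixconv !conv_ray_lt subr0. Qed.

Lemma mixconv_dist f g h u : bounded_meas f -> bounded_meas g ->
  bounded_meas h -> (forall x, `|f x - g x| <= h x) ->
  `|mixconv f u - mixconv g u| <= mixconv h u.
Proof.
move=> bf bg bh fgh; rewrite -mixconvB// ler_norml; apply/andP; split.
  rewrite lerNl -[- _]mulN1r -mixconvZ; last exact: bounded_measB.
  apply: ler_mixconv => //; first exact/bounded_measZ/bounded_measB.
  by move=> x; rewrite mulN1r; have := fgh x; rewrite ler_norml => /andP[]; lra.
apply: ler_mixconv => //; first exact: bounded_measB.
by move=> x; have := fgh x; rewrite ler_norml => /andP[]; lra.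
Qed.

Lemma bounded_meas_mixconv f : unit_fun f -> bounded_meas (mixconv f).
Proof.
move=> uf; have bf := unit_fun_bounded uf.
case: uf => _ f01 _; have f0 x : 0 <= f x by case/andP: (f01 x).
by apply: bounded_measD; apply: bounded_measZ; exact: bounded_meas_conv.
Qed.

Definition renewal_step f (u : R) : R := if u < 0 then 1 else mixconv f u.

Lemma renewal_step_unit f : unit_fun f -> unit_fun (renewal_step f).
Proof.
move=> uf; have bf := unit_fun_bounded uf; split.
- apply: measurable_fun_ifT => //; last by case: (bounded_meas_mixconv uf).
  exact: measurable_fun_ltr.
- case: uf => _ f01 _ u; rewrite /renewal_step; case: ifP => _.
    by rewrite ler01 lexx.
  have bc c : bounded_meas (fun=> c : R) by exact: bounded_meas_cst.
  rewrite -{1}(mulr0 (a + b)) -(mixconv_cst 0 u) ler_mixconv//=; last first.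
    by move=> x; case/andP: (f01 x).
  apply: (@le_trans _ _ (mixconv (fun=> 1) u)).
    by apply: ler_mixconv => // x; case/andP: (f01 x).
  by rewrite mixconv_cst mulr1 ltW.
- by move=> u u0; rewrite /renewal_step u0.
Qed.

(** The Picard iterates from 0 on the half-line: the probability that a terminating walk, each jump
    of law L with weight a or of law S with weight b, passes u within n jumps. *)
Fixpoint renewal_iter (n : nat) : R -> R :=
  if n is m.+1 then renewal_step (renewal_iter m)
  else \1_[set x | x < 0].

Lemma renewal_iter_unit n : unit_fun (renewal_iter n).
Proof.
elim: n => [|n IH]; last exact: renewal_step_unit.
split.
- by apply: measurable_indic; exact: measurable_ray_lt.
- by move=> u; rewrite /= indic_ray_lt; case: (u < 0); rewrite /= lexx ler01.
- by move=> u u0; rewrite /= indic_ray_lt u0.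
Qed.

Definition renewal_sol f := unit_fun f /\ forall u, 0 <= u -> f u = mixconv f u.

Lemma renewal_solE f u : renewal_sol f -> f u = renewal_step f u.
Proof.
by case=> -[_ _ f1 fE]; rewrite /renewal_step; have [/f1|/fE] := ltP u 0.
Qed.

(** [mixconv] contracts the uniform norm by its total mass a + b, and all functions concerned agree
    on the negative half-line. *)
Lemma renewal_iter_dist f n u : renewal_sol f ->
  `|f u - renewal_iter n u| <= (a + b) ^+ n.
Proof.
move=> sf; elim: n u => [|n IH] u.
  have [[_ f01 _] _] := sf; have [_ i01 _] := renewal_iter_unit 0.
  have := f01 u; have := i01 u; rewrite expr0 ler_norml => /andP[? ?] /andP[? ?].
  by apply/andP; split; lra.
rewrite (renewal_solE u sf) /= /renewal_step; case: ifP => _.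
  by rewrite subrr normr0 exprn_ge0// addr_ge0.
have := @mixconv_dist f (renewal_iter n) (fun=> (a + b) ^+ n) u.
rewrite mixconv_cst -exprS; apply => //.
- by apply: unit_fun_bounded; case: sf.
- exact/unit_fun_bounded/renewal_iter_unit.
- exact: bounded_meas_cst.
Qed.

Let ab0 : 0 <= a + b. Proof. exact: addr_ge0. Qed.

Let expr_small (q K e : R) : 0 <= q < 1 -> 0 < e ->
  \forall n \near \oo, K * q ^+ n <= e.
Proof.
move=> /andP[q0 q1] e0.
have : K * q ^+ n @[n --> \oo] --> K * 0.
  by apply: cvgM; [exact: cvg_cst|apply: cvg_expr; rewrite ger0_norm].
by rewrite mulr0 => h; apply: (cvgr_le _ h).
Qed.

Lemma renewal_sol_unique f g : renewal_sol f -> renewal_sol g -> f =1 g.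
Proof.
move=> sf sg u; apply/eqP; rewrite -subr_eq0 -normr_le0.
apply/ler_addgt0Pl => e e0; rewrite addr0.
have [||n _ Hn] := @expr_small (a + b) 2 e; rewrite ?ab0//.
have := Hn n (leqnn n).
have := renewal_iter_dist n u sf; have := renewal_iter_dist n u sg.
rewrite !ler_norml => /andP[? ?] /andP[? ?] ?; apply/andP; split; lra.
Qed.

Hypothesis Ssub : subexponential S.
Hypothesis L0 : L [set x | x < 0] = 0%E.
Hypothesis LS : survival L u / survival S u @[u --> +oo] --> (0 : R).

Lemma mixconv_ratio f (c : R) : unit_fun f ->
  f u / survival S u @[u --> +oo] --> c ->
  mixconv f u / survival S u @[u --> +oo] --> (a + b) * c + b.
Proof.
case=> mf f01 fn fc.
have -> : (a + b) * c + b = a * (c + 0) + b * (c + 1) by ring.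
have h1 := conv_ratio Ssub L0 LS mf f01 fn fc.
have h2 := conv_ratio Ssub (subexp_lt0 Ssub) (survival_ratio_self Ssub) mf f01 fn fc.
apply: cvg_trans (cvgD (cvgM (cvg_cst a) h1) (cvgM (cvg_cst b) h2)).
by apply: near_eq_cvg; near=> u; rewrite /mixconv !fctE/=; ring.
Unshelve. all: by end_near. Qed.

Let lim := b / (1 - (a + b)).

(** By [mixconv_ratio] the constants obey c_0 = 0 and c_(n+1) = (a + b) c_n + b, with fixed point
    [lim]. *)
Lemma renewal_iter_ratio n :
  renewal_iter n u / survival S u @[u --> +oo] --> lim * (1 - (a + b) ^+ n).
Proof.
have ne : 1 - (a + b) != 0 by rewrite gt_eqF// subr_gt0.
elim: n => [|n IH].
  rewrite expr0 subrr mulr0.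
  apply: (@cvg_trans _ ((fun=> 0 : R) @ +oo)); last exact: cvg_cst.
  apply: near_eq_cvg; near=> u.
  have u0 : 0 <= u by near: u; apply: nbhs_pinfty_ge; exact: num_real.
  by rewrite /= indic_ray_lt ltNge u0 mul0r.
have -> : lim * (1 - (a + b) ^+ n.+1) = (a + b) * (lim * (1 - (a + b) ^+ n)) + b.
  by rewrite /lim exprS; field.
apply: cvg_trans (mixconv_ratio (renewal_iter_unit n) IH).
apply: near_eq_cvg; near=> u.
have u0 : 0 <= u by near: u; apply: nbhs_pinfty_ge; exact: num_real.
by rewrite /= /renewal_step ltNge u0.
Unshelve. all: by end_near. Qed.

(* [survival S] is made constant before [u0] so that the contraction holds on the
   whole half-line and not only eventually. *)
Definition weight (u0 x : R) : R := (0 <= x)%R%:R * survival S (Num.max x u0).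

Lemma bounded_meas_weight u0 : bounded_meas (weight u0).
Proof.
have bT := bounded_meas_tail S.
split.
  apply: measurable_funM.
    have -> : (fun x => (0 <= x)%R%:R) = (\1_[set x : R | 0 <= x] : R -> R).
      by apply/funext => x; rewrite indic_ray_ge.
    by apply: measurable_indic; exact: measurable_ray_ge.
  apply: measurableT_comp; first by case: bT.
  exact: measurable_maxr.
exists 1 => x; rewrite /weight normrM [`|survival _ _|]ger0_norm ?survival_ge0//.
by case: (0 <= x); rewrite /= ?normr1 ?normr0 ?mul0r ?mul1r// survival_le1.
Qed.

(** Restricted to the half-line, [survival S] is multiplied asymptotically by a + b: of the factor
    (a + b) + b, the term b is the contribution of the negative half-line, which the weight leaves
    out. So any q strictly between a + b and 1 works far out, and before [u0] the weight is bounded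
    by a constant, on which [mixconv] acts as a + b. *)
Lemma renewal_weight : exists q u0 : R, [/\ 0 <= q < 1, 0 <= u0,
  forall v, u0 <= v -> survival L v <= survival S v &
  forall v, 0 <= v -> mixconv (weight u0) v <= q * weight u0 v].
Proof.
pose q := (1 + (a + b)) / 2.
have biv : bounded_meas (\1_[set x : R | x < 0] : R -> R).
  by apply: bounded_meas_indic; exact: measurable_ray_lt.
have bT := bounded_meas_tail S.
have bp : bounded_meas (fun x => survival S x - (\1_[set x : R | x < 0] : R -> R) x).
  exact: bounded_measB.
have H : mixconv (fun x => survival S x - (\1_[set x : R | x < 0] : R -> R) x) u
   / survival S u @[u --> +oo] --> a + b.
  have [mT _] := bounded_meas_tail S.
  have uT : unit_fun (survival S).
    split=> // [|u u0]; first exact: survival_ge0_le1.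
    exact: survival_lt0 (subexp_lt0 Ssub) u0.
  have -> : a + b = (a + b) * 1 + b - (a * 0 + b * 1) by ring.
  apply: cvg_trans (cvgB (mixconv_ratio uT (survival_ratio_self Ssub))
    (cvgD (cvgM (cvg_cst a) LS) (cvgM (cvg_cst b) (survival_ratio_self Ssub)))).
  apply: near_eq_cvg; near=> u.
  by rewrite mixconvB// mixconv_ray !fctE/=; ring.
have abq : a + b < q by have := ab1; rewrite /q; lra.
have [M1 [_ HM1]] := cvgr_le _ H _ abq.
have [M2 [_ HM2]] := cvgr_le _ LS _ ltr01.
pose u0 := Num.max 0 (Num.max (M1 + 1) (M2 + 1)).
have u00 : 0 <= u0 by rewrite le_max lexx.
have M1u v : u0 <= v -> M1 < v.
  by rewrite !ge_max => /and3P[_ + _]; lra.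
have M2u v : u0 <= v -> M2 < v.
  by rewrite !ge_max => /and3P[_ _ +]; lra.
exists q, u0; split => //.
- by have := ab1; have := ab0; rewrite /q => ? ?; apply/andP; split; lra.
- move=> v /M2u/HM2; rewrite ler_pdivrMr ?mul1r//; exact: subexp_tail_gt0.
move=> v v0; set w := weight u0.
have bw : bounded_meas w by exact: bounded_meas_weight.
have [uv|vu] := leP u0 v.
  have wv : w v = survival S v by rewrite /w /weight v0 mul1r max_l.
  rewrite wv -ler_pdivrMr ?subexp_tail_gt0//; apply: le_trans (HM1 v (M1u v uv)).
  rewrite ler_pM2r ?invr_gt0 ?subexp_tail_gt0//; apply: ler_mixconv => // x.
  rewrite /w /weight indic_ray_lt ltNge; have [x0|x0] /= := leP 0 x.
    by rewrite mul1r subr0 survival_nonincr// le_max lexx.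
  by rewrite mul0r (survival_lt0 (subexp_lt0 Ssub))// subrr.
have wv : w v = survival S u0 by rewrite /w /weight v0 mul1r max_r// ltW.
apply: (@le_trans _ _ (mixconv (fun=> survival S u0) v)).
  apply: ler_mixconv => //; first exact: bounded_meas_cst.
  move=> x; rewrite /w /weight.
  have [x0|x0] /= := leP 0 x; last by rewrite mul0r survival_ge0.
  by rewrite mul1r survival_nonincr// le_max lexx orbT.
by rewrite mixconv_cst wv ler_wpM2r ?survival_ge0// ltW.
Unshelve. all: by end_near. Qed.

(** The iterates have known ratios to the tail, so it suffices that f differs from them by a small
    multiple of the tail. The weighted contraction gives this once f itself is known to have finite
    weighted norm, which is the purpose of [iter_le] and [f_le]. *)
Lemma renewal_sol_ratio f : renewal_sol f ->
  f u / survival S u @[u --> +oo] --> b / (1 - (a + b)).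
Proof.
move=> sf; have [uf fE] := sf; have bf := unit_fun_bounded uf.
have [q [u0 [/andP[q0 q1] u00 LSu0 Hw]]] := renewal_weight.
have s0 := subexp_tail_gt0 Ssub u0.
set w := weight u0 in Hw.
have bw : bounded_meas w by exact: bounded_meas_weight.
have w0 v : 0 <= w v by rewrite mulr_ge0// survival_ge0.
(* The fixed point of K = (survival S u0)^-1 + K q: the first term covers the jump past u at once,
   the second the contraction of the previous bound. *)
pose K := (survival S u0)^-1 / (1 - q).
have K0 : 0 <= K by apply: divr_ge0; rewrite ?invr_ge0 ?subr_ge0 ltW.
have iter_le n v : 0 <= v -> renewal_iter n v <= K * w v.
  elim: n v => [|n IH] v v0.
    by rewrite /= indic_ray_lt ltNge v0 mulr_ge0.
  rewrite /= /renewal_step ltNge v0 /=.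
  have bi : bounded_meas (\1_[set x : R | x < 0] : R -> R).
    by apply: bounded_meas_indic; exact: measurable_ray_lt.
  apply: (@le_trans _ _ (mixconv (fun x => \1_[set x : R | x < 0] x + K * w x) v)).
    apply: ler_mixconv; first exact/unit_fun_bounded/renewal_iter_unit.
      by apply: bounded_measD => //; exact: bounded_measZ.
    move=> x; rewrite indic_ray_lt; have [x0|x0] /= := ltP x 0.
      have [_ i01 _] := renewal_iter_unit n; have /andP[_ i1] := i01 x.
      by rewrite (le_trans i1)// lerDl mulr_ge0.
    by rewrite add0r IH.
  rewrite mixconvD//; last exact: bounded_measZ.
  rewrite mixconvZ// mixconv_ray.
  have h1 : K * mixconv w v <= K * (q * w v) by rewrite ler_wpM2l// Hw.
  have h2 : a * survival L v + b * survival S v <= (survival S u0)^-1 * w v.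
    rewrite /w /weight v0 mul1r.
    have abS (x y z : R) : 0 <= z -> x <= z -> y <= z -> a * x + b * y <= z.
      move=> z0 xz yz; apply: (@le_trans _ _ ((a + b) * z)).
        by rewrite mulrDl lerD// ler_wpM2l.
      by rewrite ler_piMl// ltW.
    have inv1 : 1 <= (survival S u0)^-1 by rewrite invf_ge1// survival_le1.
    have [uv|vu] := leP u0 v.
      apply: abS; [by rewrite mulr_ge0 ?survival_ge0// (le_trans _ inv1)| |];
        rewrite ?(le_trans (LSu0 v uv))// ler_peMl ?survival_ge0//.
    by rewrite mulVf ?gt_eqF//; apply: abS; rewrite ?survival_le1.
  have KE : K = (survival S u0)^-1 + K * q.
    by rewrite /K; field; rewrite gt_eqF ?subr_gt0// gt_eqF.
  by rewrite [in leRHS]KE mulrDl -[K * q * _]mulrA lerD.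
(* The bound does not depend on n, so it passes to f through the uniform contraction. *)
have f_le v : 0 <= v -> f v <= K * w v.
  move=> v0; apply/ler_addgt0Pl => e e0.
  have [||n _ Hn] := @expr_small (a + b) 1 e; rewrite ?ab0//.
  have := Hn n (leqnn n); have := renewal_iter_dist n v sf; have := iter_le n v v0.
  by rewrite ler_norml mul1r => ? /andP[? ?] ?; lra.
have dist n v : `|f v - renewal_iter n v| <= K * q ^+ n * w v.
  elim: n v => [|n IH] v.
    rewrite expr0 mulr1 /= indic_ray_lt; have [v0|v0] /= := ltP v 0.
      by case: uf => _ _ ->//; rewrite subrr normr0 mulr_ge0.
    rewrite subr0 ger0_norm ?f_le//.
    by case: uf => _ f01 _; case/andP: (f01 v).
  rewrite (renewal_solE v sf) /= /renewal_step; have [v0|v0] /= := ltP v 0.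
    by rewrite subrr normr0; do 2?apply: mulr_ge0 => //; exact: exprn_ge0.
  apply: le_trans (mixconv_dist v bf _ _ IH) _.
  - exact/unit_fun_bounded/renewal_iter_unit.
  - exact: bounded_measZ.
  - have -> : K * q ^+ n.+1 * w v = K * q ^+ n * (q * w v) by rewrite exprS; ring.
    by rewrite mixconvZ// ler_wpM2l ?Hw// mulr_ge0// exprn_ge0.
apply/cvgrPdist_le => e e0; rewrite -/lim.
have e3 : 0 < e / 3 by lra.
have [|//|n1 _ Hn1] := @expr_small q K (e / 3); first by rewrite q0 q1.
have [|//|n2 _ Hn2] := @expr_small (a + b) lim (e / 3); first by rewrite ab0 ab1.
(* Chosen before u: both the weighted error K q^n and the defect lim (a + b)^n of the n-th constant
   are then small. *)
pose n := maxn n1 n2.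
have hn1 := Hn1 n (leq_maxl _ _); have hn2 := Hn2 n (leq_maxr _ _).
have lim0 : 0 <= lim by apply: divr_ge0 => //; rewrite subr_ge0 ltW.
near=> u.
have uu0 : u0 <= u by near: u; apply: nbhs_pinfty_ge; exact: num_real.
have su := subexp_tail_gt0 Ssub u.
have h1 : `|lim * (1 - (a + b) ^+ n) - renewal_iter n u / survival S u| <= e / 3.
  by near: u; move/cvgrPdist_le : (@renewal_iter_ratio n); apply.
have h2 : `|f u - renewal_iter n u| / survival S u <= e / 3.
  rewrite ler_pdivrMr// (le_trans (dist n u))//.
  rewrite /w /weight (le_trans u00 uu0) mul1r max_l// ler_wpM2r//.
  exact: survival_ge0.
have h3 : `|f u / survival S u - renewal_iter n u / survival S u| <= e / 3.
  by rewrite -mulrBl normrM [`|(survival S u)^-1|]ger0_norm ?invr_ge0 ?survival_ge0.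
have h4 : 0 <= lim * (a + b) ^+ n by rewrite mulr_ge0// exprn_ge0.
move: h1 h3; rewrite !ler_norml mulrBr mulr1 => /andP[? ?] /andP[? ?].
by apply/andP; split; lra.
Unshelve. all: by end_near. Qed.

End renewal.

(** * Lindley's recursion *)

Section layer_cake.
Context {R : realType}.
Notation mu := (@lebesgue_measure R).
Implicit Types Q : probability R R.

Definition pos (x : R) : R := Num.max 0 x.

Lemma pos_ge0 x : 0 <= pos x.
Proof. by rewrite le_max lexx. Qed.

Lemma pos_id x : 0 <= x -> pos x = x.
Proof. exact: max_r. Qed.

Lemma pos_eq0 x : x <= 0 -> pos x = 0.
Proof. exact: max_l. Qed.

Lemma measurable_fun_pos d (T : measurableType d) (f : T -> R) :
  measurable_fun setT f -> measurable_fun setT (fun x => pos (f x)).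
Proof. by move=> mf; exact: measurable_maxr. Qed.

(** For x >= 0 this truncates y to [0, x]; its mean under a law is the integrated tail, which is how
    stationary excess laws appear. *)
Definition clip (x y : R) : R := pos (Num.min y x).

Lemma bounded_meas_trunc (x : R) : 0 <= x -> bounded_meas (clip x).
Proof.
move=> x0; split.
  by apply: measurable_fun_pos; exact: measurable_minr.
by exists x => y; rewrite ger0_norm ?le_max ?lexx// ge_max x0 ge_min lexx orbT.
Qed.

Lemma clip_ge0 x y : 0 <= clip x y.
Proof. by rewrite le_max lexx. Qed.

Lemma clip_neg x y : y <= 0 -> clip x y = 0.
Proof. by move=> y0; rewrite /clip pos_eq0// ge_min y0. Qed.

Lemma clip_id x y : 0 <= y -> y <= x -> clip x y = y.
Proof. by move=> y0 yx; rewrite /clip min_l// pos_id. Qed.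

Lemma clip_max x y : 0 <= x -> x <= y -> clip x y = x.
Proof. by move=> y0 yx; rewrite /clip min_r// pos_id. Qed.

Lemma Rintegral_trunc Q (x : R) : 0 <= x ->
  \int[Q]_y clip x y = \int[mu]_(t in `[0, x]) survival Q t.
Proof.
move=> x0; have [mtr _] := bounded_meas_trunc x0.
pose X : {RV Q >-> R} := HB.pack (clip x) (isMeasurableFun.Build _ _ _ _ _ mtr).
have := @ge0_expectation_ccdf _ _ _ Q X (clip_ge0 x).
rewrite /Rintegral expectation_def => ->; congr fine.
have mt : measurable_fun setT (survival Q) by case: (bounded_meas_tail Q).
(* At t = x the tail of the truncated variable is 0 while [survival Q] need not be; this endpoint is
   Lebesgue-null. *)
rewrite -[RHS]integral_itv_bndo_bndc; last exact/measurable_EFinP/measurable_funTS.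
rewrite integral_mkcond [RHS]integral_mkcond; apply: eq_integral => t _.
rewrite !patchE !mem_setE !in_itv/= andbT; have [t0|//] := leP 0 t.
rewrite /ccdf /distribution /pushforward /=.
have [tx|xt] := ltP t x.
  rewrite /survival fineK ?fin_num_measure//; last exact: measurable_ray_gt.
  congr (Q _); rewrite predeqE => y /=; rewrite in_itv/= andbT /clip.
  by rewrite lt_max ltNge t0 /= lt_min tx andbT.
rewrite (_ : _ @^-1` _ = set0) ?measure0//.
rewrite -subset0 => y /=; rewrite in_itv/= andbT /clip lt_max ltNge t0 /=.
by rewrite lt_min [t < x]ltNge xt andbF.
Qed.

End layer_cake.

Lemma Rintegral_indic d (T : measurableType d) (R : realType)
    (P : probability T R) (D : set T) : measurable D ->
  \int[P]_w (\1_D w) = fine (P D).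
Proof. by move=> mD; rewrite /Rintegral integral_indic// setIT. Qed.

Lemma integrable_tail (R : realType) (Q : probability R R) (x : R) :
  lebesgue_measure.-integrable `[0, x] (EFin \o survival Q).
Proof.
apply: measurable_bounded_integrable => //.
- rewrite [X in (X < _)%E](lebesgue_measure_itv `[0%R, x])/=.
  by case: ifPn => // _; rewrite -EFinB ltry.
- by apply: measurable_funTS; case: (bounded_meas_tail Q).
- exists 1; split; first exact: num_real.
  move=> r r1 t _ /=; rewrite ger0_norm ?survival_ge0//.
  by rewrite (le_trans (survival_le1 _ _))// ltW.
Qed.

Section exponential.
Context {R : realType} (lambda : R) (E : probability R R).
Hypothesis expE : forall A, measurable A -> E A = exponential_prob lambda A.
Notation mu := (@lebesgue_measure R).

Lemma exp_lt_pdf (x : R) : 0 <= x -> E [set t | t < x] =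
  (\int[mu]_(t in `[0%R, x]) (exponential_pdf lambda t)%:E)%E.
Proof.
move=> x0.
rewrite expE; last exact: measurable_ray_lt.
rewrite /exponential_prob.
have mpdf (D : set R) : measurable_fun D (EFin \o exponential_pdf lambda).
  apply/measurable_EFinP; apply: measurable_funTS.
  exact: measurable_exponential_pdf.
rewrite -[RHS]integral_itv_bndo_bndc; last exact: mpdf.
rewrite integral_mkcond [RHS]integral_mkcond.
apply: eq_integral => t _; rewrite !patchE.
rewrite [t \in `[_, _[%classic](_ : _ = (0 <= t < x)); last first.
  by apply/idP/idP; rewrite inE/= in_itv.
rewrite (_ : (t \in [set t | t < x]) = (t < x)); last by apply/idP/idP; rewrite inE.
by have [//|t0] := leP 0 t; case: ifP => // _; rewrite lt0_exponential_pdf.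
Qed.

Lemma exp_lt (x : R) : 0 <= x -> fine (E [set t | t < x]) = 1 - expR (- lambda * x).
Proof.
move=> x0.
rewrite exp_lt_pdf//.
move: x0; rewrite le_eqVlt => /predU1P[<-|x0].
  by rewrite mulr0 expR0 subrr set_itv1 integral_set1.
by rewrite -[X in fine X]/(exponential_prob lambda _) exponential_prob_itv0c.
Qed.

Lemma exp_tail (x : R) : 0 <= x -> survival E x = expR (- lambda * x).
Proof.
move=> x0; rewrite survival_cdf.
suff -> : fine (E [set t | t <= x]) = 1 - expR (- lambda * x) by ring.
rewrite -exp_lt// [X in E X](_ : _ = [set t | t < x] `|` [set x]); last first.
  rewrite predeqE => y /=; rewrite le_eqVlt; split.
    by move=> /predU1P[->|]; [right|left].
  by case=> [->|->]; rewrite ?eqxx ?orbT.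
rewrite measureU//; last 2 first.
- exact: measurable_ray_lt.
- by rewrite -subset0 => y /= [] /[swap] ->; rewrite ltxx.
have E0 : E [set x] = 0%E by rewrite expE// /exponential_prob integral_set1.
by rewrite [X in (_ + X)%E](_ : _ = 0%E) ?adde0.
Qed.

(** The exponential density is lambda times the tail: the law is its own stationary excess law. *)
Lemma exp_trunc (x : R) : 0 <= x ->
  lambda * \int[E]_t clip x t = 1 - expR (- lambda * x).
Proof.
move=> x0; rewrite Rintegral_trunc// -exp_lt//.
have itail := integrable_tail E x.
rewrite -RintegralZl// exp_lt_pdf// /Rintegral; congr fine; apply: eq_integral => t.
rewrite inE/= in_itv/= => /andP[t0 _].
by rewrite exp_tail// exponential_pdfE.
Qed.

End exponential.

Section lindley.
Context {R : realType}.

(* The positive parts make the identities below hold pointwise, although the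
   claim [y] and the waiting time [t] are only almost surely nonnegative. *)
Definition lindley (x y t : R) : R :=
  pos (x + pos y - pos t).

Definition pos_gap (u x : R) : R := pos (u - x).

(** A claim y fills the gap below u by y truncated to that gap, so that averaging over the claim
    yields a truncated mean. *)
Lemma pos_gap_trunc (u x y : R) :
  pos_gap u x = pos_gap u (x + pos y) + clip (pos_gap u x) y.
Proof.
rewrite /pos_gap.
have [y0|y0] := lerP y 0.
  by rewrite (pos_eq0 y0) clip_neg// !addr0.
rewrite (pos_id (ltW y0)).
have [xu|ux] := lerP (u - x) 0.
  by rewrite (pos_eq0 xu) clip_max ?(ltW y0)// pos_eq0 ?addr0//; lra.
rewrite (pos_id (ltW ux)).
have [yu|uy] := lerP y (u - x).
  by rewrite clip_id ?(ltW y0)// pos_id; lra.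
by rewrite clip_max ?(ltW ux) ?(ltW uy)// pos_eq0; lra.
Qed.

(** During the waiting time the level falls from z by min(t, z), because it stops at 0. The part of
    the fall that takes place above u, min(t, (z - u)^+), does not widen the gap. *)
Lemma lindley_gap (u x y t : R) : 0 <= u -> 0 <= x ->
  let z := x + pos y in
  pos_gap u (lindley x y t) = pos_gap u z + (clip z t - clip (pos (z - u)) t).
Proof.
move=> u0 x0 z.
have z0 : 0 <= z by rewrite addr_ge0// pos_ge0.
rewrite /pos_gap /lindley -/z.
have [t0|t0] := lerP t 0.
  by rewrite !clip_neg// (pos_eq0 t0) !subr0 addr0 (pos_id z0).
rewrite (pos_id (ltW t0)).
have [zt|tz] := lerP z t.
  rewrite clip_max// [pos (z - t)]pos_eq0 ?subr_le0// subr0 (pos_id u0).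
  have [zu|uz] := lerP z u.
    rewrite [pos (z - u)]pos_eq0 ?subr_le0// clip_max ?lexx ?(ltW t0)//.
    by rewrite pos_id; lra.
  rewrite [pos (z - u)]pos_id ?subr_ge0 ?ltW// clip_max; [|lra|lra].
  by rewrite pos_eq0; lra.
rewrite (@clip_id _ z) ?(ltW t0) ?(ltW tz)// [pos (z - t)]pos_id ?subr_ge0 ?ltW//.
have [zu|uz] := lerP z u.
  rewrite [pos (z - u)]pos_eq0 ?subr_le0// clip_max ?lexx ?(ltW t0)//.
  by rewrite !pos_id; lra.
rewrite [pos (z - u)]pos_id ?subr_ge0 ?ltW// [pos (u - z)]pos_eq0; last lra.
have [tzu|zut] := lerP t (z - u).
  by rewrite clip_id ?(ltW t0)// pos_eq0; lra.
by rewrite clip_max ?pos_id; lra.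
Qed.

Variables (lambda : R) (E : probability R R).
Hypothesis expE : forall A, measurable A -> E A = exponential_prob lambda A.

Lemma bounded_meas_pos_gap (u : R) d (T : measurableType d) (f : T -> R) :
  measurable_fun setT f -> (forall x, 0 <= f x) ->
  bounded_meas (fun x => pos_gap u (f x)).
Proof.
move=> mf f0; split.
  by apply: measurable_fun_pos; exact: measurable_funB.
exists (pos u) => x; rewrite ger0_norm ?pos_ge0//.
by rewrite /pos_gap /pos ge_max !le_max lexx /= gerBl f0 orbT.
Qed.

Lemma measurable_lindley d (T : measurableType d) (f g h : T -> R) :
  measurable_fun setT f -> measurable_fun setT g -> measurable_fun setT h ->
  measurable_fun setT (fun x => lindley (f x) (g x) (h x)).
Proof.
move=> mf mg mh; apply: measurable_fun_pos; apply: measurable_funB.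
  by apply: measurable_funD => //; exact: measurable_fun_pos.
exact: measurable_fun_pos.
Qed.

Lemma lindley_ge0 x y t : 0 <= lindley x y t.
Proof. exact: pos_ge0. Qed.

Lemma lindley_tail (u x y : R) : 0 <= u -> 0 <= x ->
  fine (E [set t | u < lindley x y t]) =
  1 - expR (- lambda * pos (x + pos y - u)).
Proof.
move=> u0 x0; rewrite -(exp_lt expE) ?pos_ge0//.
have E0 : fine (E [set t | t < 0]) = 0.
  by rewrite (exp_lt expE)// mulr0 expR0 subrr.
rewrite /lindley; set z := x + _.
have [zu|uz] := lerP (z - u) 0.
  rewrite (pos_eq0 zu) E0; rewrite (_ : [set _ | _] = set0) ?measure0//.
  rewrite -subset0 => t /=; rewrite /pos lt_max ltNge u0 /= => h.
  have := pos_ge0 t; rewrite /pos; lra.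
rewrite (pos_id (ltW uz)); congr (fine (E _)); rewrite predeqE => t /=.
rewrite {1}/pos lt_max ltNge u0 /= ltrBrDr -ltrBrDl /pos gt_max uz.
by [].
Qed.

(* With [lindley_law_recurrence] below, this identity for an exponential waiting
   time plays the part of the integro-differential equation of the ruin
   probability, without any regularity of the claim law. *)
Lemma lindley_step (u x y : R) : 0 <= u -> 0 <= x ->
  \int[E]_t (\1_[set v | u < v] (lindley x y t) + lambda * pos_gap u (lindley x y t))
  = \int[E]_t (\1_[set v | 0 < v] (lindley x y t)) +
    lambda * pos_gap u (x + pos y).
Proof.
move=> u0 x0; set z := x + pos y.
have z0 : 0 <= z by rewrite addr_ge0// pos_ge0.
have ml : measurable_fun setT (lindley x y).
  by apply: measurable_lindley => //; exact: measurable_cst.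
have bi (c : R) : bounded_meas (fun t => \1_[set v | c < v] (lindley x y t) : R).
  have [mi [K iK]] := bounded_meas_indic (R := R) (measurable_ray_gt c).
  by split; [exact: (measurableT_comp mi ml)|exists K => t; exact: iK].
have bg : bounded_meas (fun t => pos_gap u (lindley x y t)).
  by apply: bounded_meas_pos_gap => // t; exact: lindley_ge0.
have intl (c : R) : 0 <= c -> \int[E]_t (\1_[set v | c < v] (lindley x y t) : R) =
    1 - expR (- lambda * pos (z - c)).
  move=> c0; rewrite -lindley_tail//.
  rewrite -[LHS]/(\int[E]_t (\1_[set v | c < lindley x y v] t)) Rintegral_indic//.
  by have := ml measurableT _ (measurable_ray_gt c); rewrite setTI.
rewrite RintegralD//; try exact: bounded_meas_integrable.
  rewrite RintegralZl//; last exact: bounded_meas_integrable.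
  rewrite !intl// subr0 (pos_id z0).
  under eq_Rintegral do rewrite lindley_gap//.
  have bt (c : R) : 0 <= c -> bounded_meas (clip c) by exact: bounded_meas_trunc.
  have c0 : 0 <= pos (z - u) by exact: pos_ge0.
  have bc := bounded_meas_cst (T := R) (pos_gap u z).
  rewrite RintegralD//; try apply: bounded_meas_integrable => //; last first.
    by apply: bounded_measB; exact: bt.
  rewrite -/z RintegralB//; try by apply: bounded_meas_integrable; exact: bt.
  rewrite Rintegral_cst//= probability_setT mulr1 mulrDr mulrBr.
  (* The mean widening of the gap, times lambda, is exactly the difference of the probabilities of
     exceeding 0 and u. *)
  by rewrite !(exp_trunc expE)//; ring.
by apply: bounded_meas_integrable; exact: bounded_measZ.
Qed.

End lindley.

Lemma bounded_meas_Rintegral d1 d2 (T1 : measurableType d1)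
    (T2 : measurableType d2) (R : realType) (Q : probability T2 R)
    (h : T1 * T2 -> R) :
  bounded_meas h -> bounded_meas (fun x => \int[Q]_y h (x, y)).
Proof.
move=> bh; have [mh [K hK]] := bh.
have bx x : bounded_meas (fun y => h (x, y)).
  by split; [exact: measurableT_comp|exists K].
have bound x : - K <= \int[Q]_y h (x, y) <= K.
  have cstE c : \int[Q]_y (c : R) = c.
    by rewrite Rintegral_cst//= probability_setT mulr1.
  apply/andP; split.
    rewrite -[leLHS]cstE; apply: le_Rintegral => //; try exact: bounded_meas_integrable.
      exact/bounded_meas_integrable/bounded_meas_cst.
    by move=> y _; have := hK (x, y); rewrite ler_norml => /andP[].
  rewrite -[leRHS]cstE; apply: le_Rintegral => //; try exact: bounded_meas_integrable.
    exact/bounded_meas_integrable/bounded_meas_cst.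
  by move=> y _; have := hK (x, y); rewrite ler_norml => /andP[].
split; last by exists K => x; rewrite ler_norml.
(* The shift by K makes the integrand nonnegative, as Tonelli's theorem requires. *)
have E x : \int[Q]_y h (x, y) = \int[Q]_y (h (x, y) + K) - K.
  rewrite RintegralD//; try exact: bounded_meas_integrable.
    by rewrite Rintegral_cst//= probability_setT mulr1 addrK.
  exact/bounded_meas_integrable/bounded_meas_cst.
apply: (eq_measurable_fun (fun x => \int[Q]_y (h (x, y) + K) - K)).
  by move=> x _; rewrite E.
apply: measurable_funB; last exact: measurable_cst.
apply/measurable_EFinP.
rewrite [X in measurable_fun _ X](_ : _ =
    fubini_F Q (fun z : T1 * T2 => (h z + K)%:E)); last first.
  apply/funext => x /=; rewrite EFin_Rintegral//.
  by apply: bounded_measD => //; exact: bounded_meas_cst.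
apply: measurable_fun_fubini_tonelli_F => /=; last first.
  by move=> z; rewrite lee_fin; have := hK z; rewrite ler_norml => /andP[]; lra.
by apply/measurable_EFinP; apply: measurable_funD.
Qed.

Lemma bounded_meas_comp d1 d2 (T1 : measurableType d1)
    (T2 : measurableType d2) (R : realType) (g : T2 -> R) (h : T1 -> T2) :
  bounded_meas g -> measurable_fun setT h -> bounded_meas (fun x => g (h x)).
Proof.
by move=> [mg [K gK]] mh; split; [exact: (measurableT_comp mg mh)|exists K].
Qed.

Lemma Rintegral_distribution d (T : measurableType d) (R : realType)
    (P : probability T R) (X : {RV P >-> R}) (f : R -> R) :
  bounded_meas f -> \int[distribution P X]_x f x = \int[P]_w f (X w).
Proof.
move=> bf; have [mf _] := bf; rewrite /Rintegral; congr fine.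
rewrite integral_distribution//; first exact/measurable_EFinP.
apply: (bounded_meas_integrable P (f := fun w => f (X w))).
exact: bounded_meas_comp.
Qed.

(** * Lindley's recursion as a recursion between tails *)

Section recurrence.
Context d (T : measurableType d) (R : realType) (P : probability T R).
Variables (lambda a b : R) (F E L S : probability R R).
Hypothesis expE : forall A, measurable A -> E A = exponential_prob lambda A.
Hypothesis L0 : survival L 0 = 1.
Hypothesis S0 : survival S 0 = 1.
Hypothesis truncF : forall x, 0 <= x ->
  lambda * \int[F]_y clip x y = a * (1 - survival L x) + b * (1 - survival S x).

(** X' is distributed as [lindley X U W] with X, U of law F and W of law E independent; iterated
    integrals state this without naming a joint law. *)
Definition lindley_law (X X' : T -> R) := forall G : R -> R,
  bounded_meas G -> (forall x, 0 <= G x) ->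
  \int[P]_w G (X' w) = \int[P]_w \int[F]_y \int[E]_t G (lindley (X w) y t).

(** [lindley_step] integrates out the waiting time and [pos_gap_trunc] isolates the effect of the
    claim; [truncF], applied to the gap, turns the latter into tails of L and S at u - X. *)
Lemma lindley_law_recurrence (X X' : {RV P >-> R}) (u : R) :
  (forall w, 0 <= X w) -> (forall w, 0 <= X' w) -> lindley_law X X' -> 0 <= u ->
  0 <= lambda ->
  fine (P [set w | u < X' w]) + lambda * \int[P]_w pos_gap u (X' w) =
  fine (P [set w | 0 < X' w]) + lambda * \int[P]_w pos_gap u (X w) -
  (a + b - mixconv L S a b (survival (distribution P X)) u).
Proof.
move=> X0 X'0 law u0 lambda0.
have mX : measurable_fun setT X by [].
have mX' : measurable_fun setT X' by [].
have mpos : measurable_fun setT (@pos R) by apply: measurable_fun_pos.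
have bI (c : R) : bounded_meas (\1_[set v | c < v] : R -> R).
  by apply: bounded_meas_indic; exact: measurable_ray_gt.
have bG : bounded_meas (fun x => pos_gap u (pos x)).
  by apply: bounded_meas_pos_gap => // x; exact: pos_ge0.
have IE (Y : {RV P >-> R}) (c : R) :
    fine (P [set w | c < Y w]) = \int[P]_w (\1_[set v | c < v] (Y w) : R).
  rewrite -[RHS]/(\int[P]_t (\1_[set v | c < Y v] t)) Rintegral_indic//.
  have := (@measurable_funPT _ _ _ _ Y) measurableT _ (measurable_ray_gt c).
  by rewrite setTI.
have bGX (Y : {RV P >-> R}) : (forall w, 0 <= Y w) ->
    bounded_meas (fun w => pos_gap u (Y w)).
  by move=> Y0; exact: bounded_meas_pos_gap.
have bIX (Y : {RV P >-> R}) (c : R) :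
    bounded_meas (fun w => \1_[set v | c < v] (Y w) : R).
  exact: bounded_meas_comp.
have bg := bGX _ X0; have bg' := bGX _ X'0; have bi' := bIX X' u.
rewrite !IE.
(* [pos] changes nothing at X' >= 0, but keeps the test function bounded on the whole line, as
   [lindley_law] requires. *)
have -> : \int[P]_w (\1_[set v | u < v] (X' w) : R) +
   lambda * \int[P]_w pos_gap u (X' w) =
   \int[P]_w (\1_[set v | u < v] (X' w) + lambda * pos_gap u (pos (X' w))).
  under [RHS]eq_Rintegral do rewrite pos_id//.
  rewrite RintegralD//; try exact: bounded_meas_integrable.
    by rewrite RintegralZl//; exact: bounded_meas_integrable.
  exact/bounded_meas_integrable/bounded_measZ.
rewrite (law (fun x => \1_[set v | u < v] x + lambda * pos_gap u (pos x)));
  last 2 first.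
- by apply: bounded_measD => //; exact: bounded_measZ.
- move=> x; apply: addr_ge0; first by rewrite indicE ler0n.
  by rewrite mulr_ge0 ?pos_ge0.
under eq_Rintegral => w _.
  under eq_Rintegral => y _.
    under eq_Rintegral do rewrite (pos_id (lindley_ge0 _ _ _)).
    rewrite (lindley_step expE)//.
    over.
  over.
have bgap w : bounded_meas (fun y => pos_gap u (X w + pos y)).
  apply: bounded_meas_pos_gap; last by move=> y; rewrite addr_ge0 ?pos_ge0.
  by apply: measurable_funD => //; exact: measurable_cst.
have btr w : bounded_meas (clip (pos_gap u (X w))).
  by apply: bounded_meas_trunc; exact: pos_ge0.
have bgapT : bounded_meas (fun z : T * R => pos_gap u (X z.1 + pos z.2)).
  apply: bounded_meas_pos_gap; last by move=> y; rewrite addr_ge0 ?pos_ge0.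
  apply: measurable_funD; first exact: measurableT_comp.
  exact: measurableT_comp.
have bE : bounded_meas (fun z : T * R =>
    \int[E]_t (\1_[set v | 0 < v] (lindley (X z.1) z.2 t) : R)).
  apply: (@bounded_meas_Rintegral _ _ _ _ _ _
     (fun z : (T * R) * R => \1_[set v | 0 < v] (lindley (X z.1.1) z.1.2 z.2))).
  apply: bounded_meas_comp => //; apply: measurable_lindley.
  - by apply: measurableT_comp => //; apply: measurableT_comp.
  - exact: measurableT_comp.
  - by [].
have bEw w : bounded_meas (fun y =>
    \int[E]_t (\1_[set v | 0 < v] (lindley (X w) y t) : R)).
  exact: (bounded_meas_comp bE (pair1_measurable w)).
under eq_Rintegral => w _.
  rewrite RintegralD//; first last.
  - exact/bounded_meas_integrable/bounded_measZ.
  - exact: bounded_meas_integrable.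
  rewrite RintegralZl//; last exact: bounded_meas_integrable.
  over.
have bF1 := bounded_meas_Rintegral F bE.
have bF2 := bounded_meas_Rintegral F bgapT.
rewrite /= in bF1 bF2.
rewrite RintegralD//; first last.
- exact/bounded_meas_integrable/bounded_measZ.
- exact: bounded_meas_integrable.
rewrite RintegralZl//; last exact: bounded_meas_integrable.
(* Read backwards for this indicator, the recursion turns the remaining average into P(X' > 0). *)
rewrite -(law (\1_[set v | 0 < v])) => //.
rewrite -addrA; congr (_ + _).
have btrT : bounded_meas (fun z : T * R => clip (pos_gap u (X z.1)) z.2).
  have [mg [K gK]] := bg; split.
    apply: measurable_fun_pos; apply: measurable_minr => //.
    exact: (measurableT_comp mg).
  exists K => z; rewrite ger0_norm ?pos_ge0// (le_trans _ (gK z.1))//.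
  rewrite ger0_norm ?pos_ge0// /clip /pos ge_max pos_ge0/=.
  by rewrite ge_min lexx orbT.
have btrP := bounded_meas_Rintegral F btrT.
rewrite /= in btrP.
have -> : \int[P]_w pos_gap u (X w) = \int[P]_w \int[F]_y pos_gap u (X w + pos y) +
   \int[P]_w \int[F]_y clip (pos_gap u (X w)) y.
  rewrite -RintegralD//; first last.
  - exact: bounded_meas_integrable.
  - exact: bounded_meas_integrable.
  apply: eq_Rintegral => w _; rewrite -RintegralD//; first last.
  - exact: bounded_meas_integrable.
  - exact: bounded_meas_integrable.
  under eq_Rintegral do rewrite -pos_gap_trunc.
  by rewrite Rintegral_cst//= probability_setT mulr1.
rewrite mulrDr -addrA -[LHS]addr0; congr (_ + _).
have bt (Q : probability R R) : bounded_meas (fun w => survival Q (u - X w)).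
  apply: bounded_meas_comp; first exact: bounded_meas_tail.
  by apply: measurable_funB => //; exact: measurable_cst.
have -> : lambda * \int[P]_w \int[F]_y clip (pos_gap u (X w)) y =
  \int[P]_w (a * (1 - survival L (u - X w)) + b * (1 - survival S (u - X w))).
  rewrite -RintegralZl//; last exact: bounded_meas_integrable.
  apply: eq_Rintegral => w _; rewrite truncF ?pos_ge0//.
  (* The gap and u - X differ only where u - X < 0, and there both tails are 1. *)
  have tl (Q : probability R R) : survival Q 0 = 1 ->
      survival Q (pos_gap u (X w)) = survival Q (u - X w).
    move=> Q0; rewrite /pos_gap; have [ux|/ltW xu] := lerP 0 (u - X w).
      by rewrite pos_id.
    rewrite pos_eq0// Q0; apply/eqP; rewrite eq_le survival_le1 andbT.
    by rewrite -Q0 survival_nonincr.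
  by rewrite !tl.
have b1 (Q : probability R R) : bounded_meas (fun w => 1 - survival Q (u - X w)).
  by apply: bounded_measB => //; exact: bounded_meas_cst.
have mc (Q : probability R R) : \int[P]_w (1 - survival Q (u - X w)) =
    1 - convolve Q (survival (distribution P X)) u.
  rewrite RintegralB//; first last.
  - exact: bounded_meas_integrable.
  - exact/bounded_meas_integrable/bounded_meas_cst.
  rewrite Rintegral_cst//= probability_setT mulr1 conv_tailC /convolve.
  by rewrite Rintegral_distribution//; exact/bounded_meas_reflect/bounded_meas_tail.
rewrite RintegralD//; first last.
- exact/bounded_meas_integrable/bounded_measZ.
- exact/bounded_meas_integrable/bounded_measZ.
rewrite !RintegralZl//; try exact: bounded_meas_integrable.
by rewrite !mc /mixconv; ring.
Qed.

End recurrence.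

Lemma Rintegral_bounded_cvg d (T : measurableType d) (R : realType)
    (P : probability T R) (f_ : nat -> T -> R) (f : T -> R) (K : R) :
  (forall n, measurable_fun setT (f_ n)) ->
  (forall n x, `|f_ n x| <= K) ->
  (forall x, f_ n x @[n --> \oo] --> f x) ->
  \int[P]_x f_ n x @[n --> \oo] --> \int[P]_x f x.
Proof.
move=> mf fK cf.
have mF : measurable_fun setT f.
  by apply: measurable_fun_cvg => // x _; exact: cf.
have bf : bounded_meas f.
  split=> //; exists K => x.
  apply: (cvgr_to_le (cvg_norm (cf x))); apply: nearW => n; exact: fK.
have bfn n : bounded_meas (f_ n) by split=> //; exists K.
have [] := @dominated_convergence _ _ _ P setT measurableT
  (fun n => EFin \o f_ n) (EFin \o f) (EFin \o cst K).
- by move=> n; exact/measurable_EFinP.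
- exact/measurable_EFinP.
- by apply: aeW => x _; apply: cvg_EFin; [exact: nearW|exact: cf].
- exact: bounded_meas_integrable (bounded_meas_cst K).
- by apply: aeW => x n _; rewrite lee_fin.
move=> _ _.
rewrite -EFin_Rintegral//; under eq_fun do rewrite -EFin_Rintegral//.
by move/fine_cvg.
Qed.

(** * Passage to an infinite horizon *)

Section limit.
Context d (T : measurableType d) (R : realType) (P : probability T R).
Variables (lambda a b : R) (F E L S : probability R R).
Hypothesis lambda_ge0 : 0 <= lambda.
Hypotheses (a0 : 0 <= a) (b0 : 0 <= b) (ab1 : a + b < 1).
Hypothesis expE : forall A, measurable A -> E A = exponential_prob lambda A.
Hypothesis L0 : survival L 0 = 1.
Hypothesis S0 : survival S 0 = 1.
Hypothesis truncF : forall x, 0 <= x ->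
  lambda * \int[F]_y clip x y = a * (1 - survival L x) + b * (1 - survival S x).
Variable X : nat -> {RV P >-> R}.
Hypothesis X_ge0 : forall n w, 0 <= X n w.
Hypothesis X_nd : forall w, nondecreasing_seq (fun n => X n w).
Hypothesis X_law : forall n, lindley_law P F E (X n) (X n.+1).

Let psi (u : R) : R := fine (P (\bigcup_n [set w | u < X n w])).
Let psin n (u : R) : R := survival (distribution P (X n)) u.

Let mXn n u : measurable [set w | u < X n w].
Proof.
have := (@measurable_funPT _ _ _ _ (X n)) measurableT _ (measurable_ray_gt u).
by rewrite setTI.
Qed.

Let psi_cvg u : psin n u @[n --> \oo] --> psi u.
Proof.
have : (P \o (fun n => [set w | u < X n w])) @ \oo -->
    P (\bigcup_n [set w | u < X n w]).
  apply: nondecreasing_cvg_mu => //; first exact: bigcupT_measurable.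
  move=> m n mn; apply/subsetPset => w /=; move/lt_le_trans; apply.
  exact: X_nd.
rewrite -[X in _ --> X](@fineK _ (P (\bigcup_n _))); last first.
  by apply: fin_num_measure; exact: bigcupT_measurable.
by move/fine_cvg.
Qed.

Let psin01 n u : 0 <= psin n u <= 1. Proof. exact: survival_ge0_le1. Qed.

Let psi01 u : 0 <= psi u <= 1.
Proof.
apply/andP; split.
  by apply: (cvgr_to_ge (psi_cvg (u := u))); apply: nearW => n; case/andP: (psin01 n u).
by apply: (cvgr_to_le (psi_cvg (u := u))); apply: nearW => n; case/andP: (psin01 n u).
Qed.

Let psi_nonincr : {homo psi : x y /~ x <= y}.
Proof.
move=> y x xy; apply: fine_probability_le; try exact: bigcupT_measurable.
by move=> w [n _ /= h]; exists n => //=; exact: le_lt_trans h.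
Qed.

Let unit_psi : unit_fun psi.
Proof.
split; [|exact: psi01|].
  by apply: nonincreasing_measurable => // x y /psi_nonincr.
move=> u u0; rewrite /psi (_ : \bigcup_n _ = setT) ?probability_setT//.
by rewrite -subTset => w _; exists 0%N => //=; exact: lt_le_trans u0 _.
Qed.

Let bpsin n : bounded_meas (psin n). Proof. exact: bounded_meas_tail. Qed.

Let conv_cvg (Q : probability R R) u :
  convolve Q (psin n) u @[n --> \oo] --> convolve Q psi u.
Proof.
apply: (@Rintegral_bounded_cvg _ _ _ _ _ _ 1).
- by move=> n; case: (bounded_meas_reflect u (bpsin n)).
- by move=> n x; have /andP[h1 h2] := psin01 n (u - x); rewrite ger0_norm.
- by move=> x; exact: psi_cvg.
Qed.

Let mix_cvg u : mixconv L S a b (psin n) u @[n --> \oo] --> mixconv L S a b psi u.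
Proof.
apply: cvgD; apply: cvgM; try exact: cvg_cst; exact: conv_cvg.
Qed.

Let e u n := \int[P]_w pos_gap u (X n w).

Let bgap u n : bounded_meas (fun w => pos_gap u (X n w)).
Proof. exact: bounded_meas_pos_gap. Qed.

Let e_nonincr u : nonincreasing_seq (e u).
Proof.
move=> m n mn; apply: le_Rintegral => //; try exact: bounded_meas_integrable.
by move=> w _; rewrite /pos_gap /pos ge_max !le_max lexx /= lerB ?orbT// X_nd.
Qed.

(** The mean gap is nonincreasing in n and nonnegative, hence convergent. *)
Let e_diff u : lambda * (e u n - e u n.+1) @[n --> \oo] --> (0 : R).
Proof.
have ec : cvgn (e u).
  apply: nonincreasing_is_cvgn; first exact: e_nonincr.
  by exists 0 => _ [n _ <-]; apply: Rintegral_ge0 => w _; exact: pos_ge0.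
rewrite -(mulr0 lambda) -(subrr (limn (e u))).
apply: cvgM; first exact: cvg_cst.
apply: cvgB; first exact: ec.
by have := ec; rewrite -(cvg_shiftS (e u)).
Qed.

Let rec u n : 0 <= u -> psin n.+1 u =
  psin n.+1 0 - (a + b) + mixconv L S a b (psin n) u + lambda * (e u n - e u n.+1).
Proof.
move=> u0.
have := @lindley_law_recurrence _ _ _ P lambda a b F E L S expE L0 S0 truncF
  (X n) (X n.+1) u (X_ge0 n) (X_ge0 n.+1) (X_law n) u0 lambda_ge0.
rewrite -[fine (P [set w | u < _])]/(psin n.+1 u).
rewrite -[fine (P [set w | 0 < _])]/(psin n.+1 0).
rewrite -/(e u n) -/(e u n.+1) -/(psin n) mulrBr.
by lra.
Qed.

(** For fixed n the left side of [rec] vanishes as u grows, while the last two terms on its right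
    are nonnegative. *)
Let psin0_le n : psin n.+1 0 <= a + b.
Proof.
apply/ler_addgt0Pl => eps eps0.
near (@pinfty_nbhs R) => u.
have u0 : 0 <= u by near: u; apply: nbhs_pinfty_ge; exact: num_real.
have h : psin n.+1 u <= eps by near: u; apply: (cvgr_le _ (@survival_cvg0 _ _)).
have := rec n u0.
have := lambda_ge0; have := e_nonincr u (leqnSn n).
have A0 : 0 <= mixconv L S a b (psin n) u.
  apply: addr_ge0; apply: mulr_ge0 => //.
    by case/andP: (conv_ge0_le1 L u (bpsin n) (psin01 n)).
  by case/andP: (conv_ge0_le1 S u (bpsin n) (psin01 n)).
rewrite -subr_ge0 => h1 h2; have := mulr_ge0 h2 h1; lra.
Unshelve. all: by end_near. Qed.

Let psi_eq u : 0 <= u -> psi u = psi 0 - (a + b) + mixconv L S a b psi u.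
Proof.
move=> u0.
have h (v : R) : psin n.+1 v @[n --> \oo] --> psi v.
  by have := psi_cvg (u := v); rewrite -(cvg_shiftS (fun n => psin n v)).
have fE : (fun n => psin n.+1 u) = fun n => psin n.+1 0 - (a + b) +
    mixconv L S a b (psin n) u + lambda * (e u n - e u n.+1).
  by apply/funext => n; exact: rec.
have hu := h u; rewrite fE in hu.
rewrite -[RHS]addr0; apply: (cvg_unique _ hu) => //.
apply: cvgD; last exact: e_diff.
apply: cvgD; last exact: mix_cvg.
by apply: cvgB; [exact: h|exact: cvg_cst].
Qed.

Let psi0_le : psi 0 <= a + b.
Proof.
have h : psin n.+1 0 @[n --> \oo] --> psi 0.
  by have := psi_cvg (u := 0); rewrite -(cvg_shiftS (fun n => psin n 0)).
by apply: (cvgr_to_le h); apply: nearW => n; exact: psin0_le.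
Qed.

(* As [u] tends to infinity, [psi_eq] gives [l * (1 - (a + b)) = psi 0 - (a + b)]
   for the limit [l >= 0] of [psi], and the right-hand side is nonpositive. So
   [l = 0]: the supremum is finite, without any law of large numbers. *)
Let psi0E : psi 0 = a + b.
Proof.
have [l pl] : exists l : R, psi u @[u --> +oo] --> l.
  have : nondecreasing_fun (fun u => - psi u).
    by move=> x y xy; rewrite lerN2 psi_nonincr.
  move/nondecreasing_cvgr => h; eexists (- _).
  rewrite -[psi]opprK; apply: cvgN; apply: h.
  by exists 0 => _ [x _ <-]; rewrite oppr_le0; case/andP: (psi01 x).
have l0 : 0 <= l.
  by apply: (cvgr_to_ge pl); apply: nearW => u; case/andP: (psi01 u).
(* The limit is taken along the integers because [Rintegral_bounded_cvg] concerns sequences. *)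
have cl (Q : probability R R) : convolve Q psi n%:R @[n --> \oo] --> l.
  rewrite -(conv_cst Q l 0).
  apply: (@Rintegral_bounded_cvg _ _ _ _ _ _ 1).
  - by move=> n; case: (bounded_meas_reflect n%:R (unit_fun_bounded unit_psi)).
  - by move=> n x; have /andP[? ?] := psi01 (n%:R - x); rewrite ger0_norm.
  - move=> x; apply: (cvg_comp _ _ _ pl).
    apply/cvgryPge => A; near=> n; rewrite lerBrDr; near: n.
    exact: nbhs_infty_ger.
have ln : psi n%:R @[n --> \oo] --> l by exact: (cvg_comp _ _ cvgr_idn pl).
have lE : l = psi 0 - (a + b) + (a * l + b * l).
  have fE : (fun n => psi n%:R) = fun n =>
      psi 0 - (a + b) + mixconv L S a b psi n%:R.
    by apply/funext => n; exact: psi_eq.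
  rewrite fE in ln; apply: (cvg_unique _ ln) => //.
  apply: cvgD; first exact: cvg_cst.
  by apply: cvgD; apply: cvgM; [exact: cvg_cst|exact: cl|exact: cvg_cst|exact: cl].
have : l * (1 - (a + b)) = psi 0 - (a + b).
  by rewrite mulrBr mulr1 mulrDr ![l * _]mulrC; lra.
have h1 := psi0_le; move=> h2.
have h3 : 0 <= l * (1 - (a + b)) by rewrite mulr_ge0// subr_ge0 ltW.
by apply/eqP; rewrite eq_le h1 /=; lra.
Unshelve. all: by end_near. Qed.

Lemma lindley_limit_renewal : renewal_sol L S a b psi.
Proof.
split=> // u u0; rewrite psi_eq// psi0E; ring.
Qed.

End limit.

(** * The claim surplus walk *)

(** Conditionally on G, the law of (X, Y) agrees with the product of [m1] and [m2] on rectangles,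
    hence everywhere by uniqueness of product measures. A null G, which allows no conditioning,
    makes both sides 0. *)
Lemma indep_pair_event d d1 d2 (T : measurableType d) (T1 : measurableType d1)
    (T2 : measurableType d2) (R : realType) (P : probability T R)
    (m1 : probability T1 R) (m2 : probability T2 R)
    (X : T -> T1) (Y : T -> T2) (G : set T) :
  measurable_fun setT X -> measurable_fun setT Y -> measurable G ->
  (forall A B, measurable A -> measurable B ->
    P (X @^-1` A `&` Y @^-1` B `&` G) = (m1 A * m2 B * P G)%E) ->
  forall K, measurable K ->
    P ((fun w => (X w, Y w)) @^-1` K `&` G) = ((m1 \x m2) K * P G)%E.
Proof.
move=> mX mY mG rect K mK.
have mXY : measurable_fun setT (fun w => (X w, Y w)) by exact: measurable_fun_pair.
have [PG0|PG0] := eqVneq (P G) 0%E.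
  rewrite PG0 mule0; apply/eqP; rewrite eq_le measure_ge0 andbT -PG0.
  by rewrite le_measure ?inE//; apply: measurableI => //; exact: measurable_preimage.
have pG : (0 < fine (P G))%R.
  by rewrite fine_gt0// lt0e PG0 measure_ge0 -ge0_fin_numE ?fin_num_measure.
have EPG : P G = (fine (P G))%:E by rewrite fineK ?fin_num_measure.
pose XY : {mfun T >-> (T1 * T2)%type} :=
  HB.pack (fun w => (X w, Y w)) (isMeasurableFun.Build _ _ _ _ _ mXY).
pose cP : probability T R := mnormalize (mrestr P mG) P.
have nuE H : distribution cP XY H =
    (P ((fun w => (X w, Y w)) @^-1` H `&` G) * ((fine (P G))^-1)%:E)%E.
  rewrite /distribution /pushforward /cP /= /mnormalize /= /mrestr setTI (negbTE PG0)/=.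
  by rewrite ifF// EPG.
have -> : ((m1 \x m2) K = distribution cP XY K)%E.
  apply: product_measure_unique => // A B mA mB.
  rewrite [LHS]nuE [X in P (X `&` _)](_ : _ = X @^-1` A `&` Y @^-1` B)//.
  rewrite rect// [in X in (_ * X * _)%E]EPG -muleA -EFinM divff ?mule1//.
  by rewrite gt_eqF.
by rewrite [X in (X * _)%E]nuE [X in (_ * X)%E]EPG -muleA -EFinM mulVf ?mule1// gt_eqF.
Qed.

Lemma Rintegral_pair d1 d2 (T1 : measurableType d1) (T2 : measurableType d2)
    (R : realType) (m1 : probability T1 R) (m2 : probability T2 R)
    (g : T1 * T2 -> R) (m : {measure set (T1 * T2) -> \bar R}) :
  bounded_meas g -> (forall z, 0 <= g z) ->
  (forall A, measurable A -> m A = (m1 \x m2)%E A) ->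
  \int[m]_z g z = \int[m1]_x \int[m2]_y g (x, y).
Proof.
move=> bg g0 mE; have [mg [K gK]] := bg.
have bI := bounded_meas_Rintegral m2 bg.
have bx x : bounded_meas (fun y => g (x, y)).
  by split; [exact: measurableT_comp|exists K].
rewrite /Rintegral; congr fine.
rewrite (eq_measure_integral (m1 \x m2)%E); last by move=> A mA _; exact: mE.
rewrite fubini_tonelli1; last 2 first.
- exact/measurable_EFinP.
- by move=> z; rewrite lee_fin.
by apply: eq_integral => x _; rewrite /fubini_F -EFin_Rintegral.
Qed.

Lemma Rintegral_change d1 d2 (T1 : measurableType d1) (T2 : measurableType d2)
    (R : realType) (mu : probability T1 R) (nu : probability T2 R)
    (phi : T1 -> T2) (g : T2 -> R) :
  measurable_fun setT phi -> bounded_meas g -> (forall z, 0 <= g z) ->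
  (forall D, measurable D -> nu D = mu (phi @^-1` D)) ->
  \int[nu]_z g z = \int[mu]_x g (phi x).
Proof.
move=> mphi [mg _] g0 nuE; rewrite /Rintegral; congr fine.
have mEG : measurable_fun setT (EFin \o g) by exact/measurable_EFinP.
have EG0 : {in setT, forall y, (0 <= (EFin \o g) y)%E}.
  by move=> x _; rewrite lee_fin.
have := ge0_integral_pushforward mphi mu measurableT mEG EG0.
rewrite preimage_setT => <-.
by apply: eq_measure_integral => D mD _; exact: nuE.
Qed.

Section lindley_walk.
Context d (T : measurableType d) (R : realType) (P : probability T R).
Variables (U W : nat -> {RV P >-> R}) (F E : probability R R).

(** Events of the past before step j; [rectE] then says that the steps are independent with law F x
    E. *)
Fixpoint rect_event (A B : nat -> set R) (j : nat) : set T :=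
  if j is i.+1 then
    rect_event A B i `&` (U i @^-1` A i `&` W i @^-1` B i)
  else setT.

Hypothesis rectE : forall A B j,
  (forall i, measurable (A i)) -> (forall i, measurable (B i)) ->
  P (rect_event A B j.+1) = (P (rect_event A B j) * (F (A j) * E (B j)))%E.

(* The step of index [j] is prepended to the walk of the steps of index [> j],
   which is independent of it: this gives the recursion of [lindley_law]. *)
Fixpoint walk_max (j n : nat) (w : T) : R :=
  if n is m.+1 then lindley (walk_max j.+1 m w) (U j w) (W j w) else 0.

Lemma walk_max_ge0 j n w : 0 <= walk_max j n w.
Proof. by case: n => [|n] //=; exact: lindley_ge0. Qed.

Lemma measurable_walk_max j n : measurable_fun setT (walk_max j n).
Proof.
elim: n j => [|n IH] j /=; first exact: measurable_cst.
exact: measurable_lindley.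
Qed.

Definition walk_maxRV j n : {RV P >-> R} :=
  HB.pack (walk_max j n)
    (isMeasurableFun.Build _ _ _ _ _ (@measurable_walk_max j n)).

Lemma walk_max_nd w : nondecreasing_seq (fun n => walk_max 0 n w).
Proof.
(* The starting index is generalized, since the recursion shifts it. *)
apply/nondecreasing_seqP => n; move: 0%N.
elim: n => [|n IH] j; first exact: walk_max_ge0.
rewrite /= /lindley /pos ge_max !le_max lexx /=.
by rewrite lerB ?orbT// lerD// IH.
Qed.

Let mrect A B j : (forall i, measurable (A i)) -> (forall i, measurable (B i)) ->
  measurable (rect_event A B j).
Proof.
move=> mA mB; elim: j => [|j IH]; first exact: measurableT.
by apply: measurableI => //; apply: measurableI; exact: measurable_preimage.
Qed.

Let rect_ext A B A' B' j : (forall i, (i < j)%N -> A i = A' i) ->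
  (forall i, (i < j)%N -> B i = B' i) -> rect_event A B j = rect_event A' B' j.
Proof.
elim: j => //= j IH hA hB; rewrite IH ?hA ?hB// => i ij.
- by rewrite hA// ltnS ltnW.
- by rewrite hB// ltnS ltnW.
Qed.

(** Stationarity and independence of the past in one statement, because the induction on n uses both
    at once. *)
Definition walk_law_at n := forall A B j (D : set R),
  (forall i, measurable (A i)) -> (forall i, measurable (B i)) -> measurable D ->
  P (walk_max j n @^-1` D `&` rect_event A B j) =
  (P (walk_max 0 n @^-1` D) * P (rect_event A B j))%E.

Let step n : walk_law_at n -> forall A B j (K : set (R * (R * R))),
  (forall i, measurable (A i)) -> (forall i, measurable (B i)) -> measurable K ->
  P ((fun w => (walk_max j.+1 n w, (U j w, W j w))) @^-1` K `&` rect_event A B j) =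
  ((distribution P (walk_maxRV 0 n) \x (F \x E)) K * P (rect_event A B j))%E.
Proof.
move=> IH A B j K mA mB mK.
apply: indep_pair_event => //.
- exact: measurable_walk_max.
- exact: measurable_fun_pair.
- exact: mrect.
move=> C K2 mC mK2.
rewrite -setIA setICA.
have mM : measurable (walk_max j.+1 n @^-1` C).
  by apply: measurable_preimage => //; exact: measurable_walk_max.
have GE : P (walk_max j.+1 n @^-1` C `&` rect_event A B j) =
    (distribution P (walk_maxRV 0 n) C * P (rect_event A B j))%E.
  (* A trivial constraint at index j presents the past before j as a past before j + 1, where the
     induction hypothesis applies. *)
  pose A' i := if (i == j)%N then setT else A i.
  pose B' i := if (i == j)%N then setT else B i.
  have mA' i : measurable (A' i) by rewrite /A'; case: eqP.
  have mB' i : measurable (B' i) by rewrite /B'; case: eqP.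
  have rE : rect_event A B j = rect_event A' B' j.+1.
    rewrite /= /A' /B' eqxx !preimage_setT !setIT.
    by apply: rect_ext => i ij; rewrite ltn_eqF.
  by rewrite rE IH.
rewrite (@indep_pair_event _ _ _ _ _ _ _ _ F E)//.
- by rewrite GE muleCA muleA.
- by apply: measurableI => //; exact: mrect.
move=> A0 B0 mA0 mB0.
(* Here the event on step j itself is absorbed into the past before j + 1. *)
pose A' i := if (i == j)%N then A0 else A i.
pose B' i := if (i == j)%N then B0 else B i.
have mA' i : measurable (A' i) by rewrite /A'; case: eqP.
have mB' i : measurable (B' i) by rewrite /B'; case: eqP.
have rE : rect_event A B j = rect_event A' B' j.
  by apply: rect_ext => i ij; rewrite /A' /B' ltn_eqF.
rewrite setICA [X in P (_ `&` X)]setIC GE rE.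
rewrite -[X in P (_ `&` X)]/(rect_event A' B' j `&` _).
have -> : rect_event A' B' j `&` (U j @^-1` A0 `&` W j @^-1` B0) =
    rect_event A' B' j.+1.
  by rewrite /= {3}/A' {3}/B' eqxx.
rewrite IH// rectE// {2}/A' {2}/B' eqxx.
by rewrite [RHS]muleC muleA.
Qed.

Let mphi : measurable_fun setT (fun z : R * (R * R) => lindley z.1 z.2.1 z.2.2).
Proof.
apply: measurable_lindley => //.
- by apply: measurableT_comp.
- by apply: measurableT_comp.
Qed.

Lemma walk_law n : walk_law_at n.
Proof.
elim: n => [|n IH] A B j D mA mB mD.
  rewrite /=; have [D0|D0] := pselect (D 0).
    rewrite (_ : _ @^-1` D = setT); last by rewrite -subTset.
    by rewrite setTI probability_setT mul1e.
  rewrite (_ : _ @^-1` D = set0); last by rewrite -subset0.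
  by rewrite set0I measure0 mul0e.
have mK := measurable_preimage mphi mD.
have := step IH j mA mB mK; rewrite -/(walk_max j n.+1) => H.
(* The same identity at index 0 with a trivial past identifies the product measure with the law of
   the walk from 0. *)
have H0 := @step n IH (fun=> setT) (fun=> setT) 0 _ (fun=> measurableT)
  (fun=> measurableT) mK.
rewrite /= setIT probability_setT mule1 in H0.
by rewrite -[LHS]/(P ((fun w => (walk_max j.+1 n w, (U j w, W j w))) @^-1`
  ((fun z : R * (R * R) => lindley z.1 z.2.1 z.2.2) @^-1` D) `&` rect_event A B j))
  H -H0.
Qed.

Lemma walk_lindley_law n :
  lindley_law P F E (walk_maxRV 0 n) (walk_maxRV 0 n.+1).
Proof.
move=> G bG G0; have [mG _] := bG.
pose phi := fun z : R * (R * R) => lindley z.1 z.2.1 z.2.2.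
have bGphi : bounded_meas (G \o phi) by exact: bounded_meas_comp.
have bGl x : bounded_meas (fun z : R * R => G (lindley x z.1 z.2)).
  apply: bounded_meas_comp => //.
  by apply: measurable_lindley => //; exact: measurable_cst.
have bGll x y : bounded_meas (fun t : R => G (lindley x y t)).
  apply: bounded_meas_comp => //.
  by apply: measurable_lindley => //; exact: measurable_cst.
have bI x := bounded_meas_Rintegral E (bGl x).
have bG3 : bounded_meas (fun z : (R * R) * R => G (lindley z.1.1 z.1.2 z.2)).
  apply: bounded_meas_comp => //; apply: measurable_lindley => //.
  - by apply: measurableT_comp.
  - by apply: measurableT_comp.
have bI2 := bounded_meas_Rintegral F (bounded_meas_Rintegral E bG3).
pose FE : probability (R * R)%type R := (F \x E)%E.
pose pi : probability (R * (R * R))%type R :=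
  (distribution P (walk_maxRV 0 n) \x FE)%E.
rewrite -(@Rintegral_distribution _ _ _ P (walk_maxRV 0 n.+1))//.
rewrite -(@Rintegral_distribution _ _ _ P (walk_maxRV 0 n)
  (fun x => \int[F]_y \int[E]_t G (lindley x y t)))//.
transitivity (\int[pi]_z G (phi z)).
  apply: Rintegral_change => // D mD.
  have := @step n (@walk_law n) (fun=> setT) (fun=> setT) 0 _ (fun=> measurableT)
    (fun=> measurableT) (measurable_preimage mphi mD).
  rewrite /= setIT probability_setT mule1 => H.
  exact: H.
apply: (etrans (@Rintegral_pair _ _ _ _ _ (distribution P (walk_maxRV 0 n)) FE
  (G \o phi) pi bGphi _ _)) => //; first by move=> z; exact: G0.
apply: eq_Rintegral => x _.
apply: (etrans (@Rintegral_pair _ _ _ _ _ F E _ FE (bGl x) _ _)) => //.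
Qed.

End lindley_walk.

Lemma probability_eq_off_null d (T : measurableType d) (R : realType)
    (P : probability T R) (A B Z : set T) :
  measurable A -> measurable B -> measurable Z -> P Z = 0%E ->
  (forall w, ~ Z w -> A w <-> B w) -> P A = P B.
Proof.
move=> mA mB mZ Z0 AB.
have le (C D : set T) : measurable C -> measurable D ->
    (forall w, ~ Z w -> C w -> D w) -> (P C <= P D)%E.
  move=> mC mD CD; apply: (@le_trans _ _ (P (D `|` Z))).
    rewrite le_measure ?inE//; first exact: measurableU.
    by move=> w Cw; have [zw|nz] := pselect (Z w); [right|left; exact: CD].
  apply: le_trans (measureU2 _ mD mZ) _.
  by rewrite [X in (_ + X <= _)%E](_ : _ = 0%E) ?adde0.
by apply/eqP; rewrite eq_le !le// => w /AB[].
Qed.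

Lemma rect_eventP d (T : measurableType d) (R : realType)
    (P : probability T R) (U W : nat -> {RV P >-> R}) A B j w :
  rect_event U W A B j w <-> forall i, (i < j)%N -> A i (U i w) /\ B i (W i w).
Proof.
elim: j => [|j IH]; first by split.
split=> [[/IH h [hU hW]] i|h].
  by rewrite ltnS leq_eqVlt => /predU1P[->//|/h].
split; last by have [] := h j (ltnSn j).
by apply/IH => i ij; apply: h; rewrite ltnS ltnW.
Qed.

(** * From the risk process in continuous time to the walk *)

Section model.
Context d (T : measurableType d) (R : realType) (P : probability T R).
Variables (lambda : R) (N : R -> T -> nat) (U W : nat -> {RV P >-> R}).
Variables (F E : probability R R).
Hypothesis W_indep : mutually_independent P (fun k => sigma_rv (W k)).
Hypothesis W_law : forall k A, measurable A -> P (W k @^-1` A) = E A.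
Hypothesis E_tail0 : survival E 0 = 1.
Hypothesis N_count : forall (t : R) w n, 0 <= t ->
  (n <= N t w)%N = (\sum_(k < n) W k w <= t).
Hypothesis U_indep : mutually_independent P (fun i => sigma_rv (U i)).
Hypothesis U_law : forall i A, measurable A -> P (U i @^-1` A) = F A.
Hypothesis F_lt0 : F [set x | x < 0] = 0%E.
Hypothesis NU_indep : independent P (sigma_process `[0, +oo[ N)
                                    (sigma_process [set: nat] U).

(** Off this null set claims are nonnegative and arrival times strictly increase, so that the path
    identities hold. *)
Let bad : set T :=
  \bigcup_k (W k @^-1` [set x | x <= 0] `|` U k @^-1` [set x | x < 0]).

Let mbad : measurable bad.
Proof.
apply: bigcupT_measurable => k; apply: measurableU.
- by apply: measurable_preimage => //; exact: measurable_ray_le.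
- by apply: measurable_preimage => //; exact: measurable_ray_lt.
Qed.

Let bad0 : P bad = 0%E.
Proof.
have mk k : measurable (W k @^-1` [set x | x <= 0] `|` U k @^-1` [set x | x < 0]).
  apply: measurableU.
  - by apply: measurable_preimage => //; exact: measurable_ray_le.
  - by apply: measurable_preimage => //; exact: measurable_ray_lt.
apply: measure_negligible => //; apply: negligible_bigcup => k.
apply/negligibleP => //; apply/eqP; rewrite eq_le measure_ge0 andbT.
set A1 := W k @^-1` _; set A2 := U k @^-1` _.
apply: (@le_trans _ _ (P A1 + P A2)%E).
  apply: measureU2.
  - by apply: measurable_preimage => //; exact: measurable_ray_le.
  - by apply: measurable_preimage => //; exact: measurable_ray_lt.
rewrite W_law; last exact: measurable_ray_le.
rewrite U_law; last exact: measurable_ray_lt.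
rewrite F_lt0 adde0.
have := E_tail0; rewrite survival_cdf => /eqP.
rewrite subr_eq addrC -subr_eq subrr eq_sym => /eqP h.
have mr := @measurable_ray_le R 0.
by rewrite -(@fineK _ (E [set x | x <= 0])) ?fin_num_measure// h.
Qed.

(** The positive part is taken because [N_count] compares the partial sum with nonnegative times
    only. *)
Let arrival n (w : T) : R := pos (\sum_(k < n) W k w).

Let TN := g_sigma_algebraType (\bigcup_(t in `[0, +oo[) sigma_rv (N t)).

(** For r >= 0, the n-th arrival is later than r exactly when N counts fewer than n claims at time
    r. *)
Let arrival_meas n : measurable_fun [set: TN] (arrival n : TN -> R).
Proof.
apply: (measurability (@RGenOInfty.G R)); first exact: RGenOInfty.measurableE.
move=> _ [_ [r ->] <-]; rewrite setTI.
have [r0|r0] := ltP r 0.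
  rewrite (_ : _ @^-1` _ = setT); first exact: measurableT.
  rewrite -subTset => w _ /=; rewrite in_itv/= andbT.
  by rewrite (lt_le_trans r0)// pos_ge0.
apply: sub_sigma_algebra; exists r; first by rewrite /= in_itv/= r0.
exists [set k | (k < n)%N] => //; rewrite setTI predeqE => w /=.
rewrite in_itv/= andbT ltnNge N_count//.
rewrite /arrival /pos lt_max ltNge r0 /= -ltNge.
by split.
Qed.

(* Unlike [W i], to which it is almost surely equal, [gap i] is measurable with
   respect to the claim counting process. *)
Let gap i (w : T) : R := arrival i.+1 w - arrival i w.

Let gap_meas i : measurable_fun [set: TN] (gap i : TN -> R).
Proof. exact: measurable_funB. Qed.

Let arrival_measT n : measurable_fun [set: T] (arrival n).
Proof. by apply: measurable_fun_pos; exact: measurable_sum. Qed.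

Let sum_ge0 n w : ~ bad w -> 0 <= \sum_(k < n) W k w.
Proof.
move=> nb; apply: sumr_ge0 => k _; rewrite leNgt; apply/negP => h.
by apply: nb; exists k => //; left => /=; exact: ltW.
Qed.

Let gapE i w : ~ bad w -> gap i w = W i w.
Proof.
move=> nb; rewrite /gap /arrival !pos_id ?sum_ge0// big_ord_recr/=.
by rewrite addrAC subrr add0r.
Qed.

(** [NU_indep] applies to [gap], not to W; the exchange off [bad] is made before using independence
    and undone afterwards. *)
Let prect A B j : (forall i, measurable (A i)) -> (forall i, measurable (B i)) ->
  P (rect_event U W A B j) = (\prod_(i <- iota 0 j) (F (A i) * E (B i)))%E.
Proof.
move=> mA mB.
pose UA := \bigcap_(i in [set` iota 0 j]) U i @^-1` A i.
pose WB := \bigcap_(i in [set` iota 0 j]) W i @^-1` B i.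
pose GB := \bigcap_(i in [set` iota 0 j]) gap i @^-1` B i.
have mbig (D : nat -> set T) : (forall i, measurable (D i)) ->
    measurable (\bigcap_(i in [set` iota 0 j]) D i).
  by move=> mD; apply: bigcap_measurableType => i _.
have mUA : measurable UA by apply: mbig => i; exact: measurable_preimage.
have mWB : measurable WB by apply: mbig => i; exact: measurable_preimage.
have mGB : measurable GB.
  apply: mbig => i; apply: measurable_preimage => //.
  exact: measurable_funB.
have rectE : rect_event U W A B j = WB `&` UA.
  rewrite predeqE => w; split=> [/rect_eventP h|[h1 h2]].
    by split=> i /=; rewrite mem_iota => /h[].
  apply/rect_eventP => i ij.
  by split; [apply: h2|apply: h1]; rewrite /= mem_iota.
have E1 : P (WB `&` UA) = P (GB `&` UA).
  apply: (probability_eq_off_null (Z := bad)) => //; try exact: measurableI.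
  move=> w nb; split=> -[h1 h2]; split=> // i ij /=.
    by rewrite gapE//; exact: h1.
  by have := h1 i ij; rewrite /= gapE.
have E2 : P GB = P WB.
  apply: (probability_eq_off_null (Z := bad)) => // w nb; split=> h1 i ij /=.
    by have := h1 i ij; rewrite /= gapE.
  by rewrite gapE//; exact: h1.
rewrite rectE E1 NU_indep.
- rewrite E2 W_indep ?iota_uniq//; last by move=> i _; exists (B i); rewrite ?setTI.
  rewrite U_indep ?iota_uniq//; last by move=> i _; exists (A i); rewrite ?setTI.
  rewrite big_split/= muleC; congr (_ * _)%E.
    by apply: eq_bigr => i _; exact: U_law.
  by apply: eq_bigr => i _; exact: W_law.
- have : @measurable _ TN GB.
    apply: bigcap_measurableType => i _.
    exact: (measurable_preimage (gap_meas i)).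
  by [].
- have : @measurable _
      (g_sigma_algebraType (\bigcup_(i in [set: nat]) sigma_rv (U i))) UA.
    apply: bigcap_measurableType => i _; apply: sub_sigma_algebra.
    by exists i => //; exists (A i); rewrite ?setTI.
  by [].
Qed.

Let rect_step A B j : (forall i, measurable (A i)) -> (forall i, measurable (B i)) ->
  P (rect_event U W A B j.+1) = (P (rect_event U W A B j) * (F (A j) * E (B j)))%E.
Proof.
move=> mA mB; rewrite !prect// -addn1 iotaD big_cat/= big_seq1 add0n.
by [].
Qed.

(** Off [bad] the positive parts in [lindley] around U and W disappear, and unrolling it yields the
    maximum of the partial sums of U - W from step j on: this lemma is the bound,
    [walk_max_attained] the attainment. *)
Lemma walk_max_ge (j n k : nat) w : ~ bad w -> (k <= n)%N ->
  \sum_(i < k) (U (j + i)%N w - W (j + i)%N w) <= walk_max U W j n w.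
Proof.
move=> nb; elim: n j k => [|n IH] j [|k]//; try by rewrite big_ord0 walk_max_ge0.
rewrite ltnS => kn; rewrite big_ord_recl /= addn0.
have U0 : 0 <= U j w.
  by rewrite leNgt; apply/negP => h; apply: nb; exists j => //; right.
have W0 : 0 <= W j w.
  rewrite leNgt; apply/negP => h; apply: nb; exists j => //.
  by left => /=; exact: ltW.
rewrite /lindley (pos_id U0) (pos_id W0) /pos le_max; apply/orP; right.
have := IH j.+1 k kn.
rewrite (eq_bigr (fun i : 'I_k => U (j + (bump 0 i))%N w - W (j + bump 0 i)%N w)).
  by lra.
by move=> i _; rewrite /bump add1n addnS addSn.
Qed.

Lemma walk_max_attained (j n : nat) w : ~ bad w -> exists2 k, (k <= n)%N &
  walk_max U W j n w = \sum_(i < k) (U (j + i)%N w - W (j + i)%N w).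
Proof.
move=> nb; elim: n j => [|n IH] j.
  by exists 0%N => //; rewrite big_ord0.
have [k kn kE] := IH j.+1.
have U0 : 0 <= U j w.
  by rewrite leNgt; apply/negP => h; apply: nb; exists j => //; right.
have W0 : 0 <= W j w.
  rewrite leNgt; apply/negP => h; apply: nb; exists j => //.
  by left => /=; exact: ltW.
rewrite /= /lindley (pos_id U0) (pos_id W0).
have [h|h] := lerP 0 (walk_max U W j.+1 n w + U j w - W j w); last first.
  by exists 0%N => //; rewrite big_ord0 pos_eq0// ltW.
exists k.+1 => //; rewrite pos_id// big_ord_recl /= addn0 kE.
rewrite (eq_bigr (fun i : 'I_k => U (j + (bump 0 i))%N w - W (j + bump 0 i)%N w)).
  by ring.
by move=> i _; rewrite /bump add1n addnS addSn.
Qed.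

(* The supremum is attained at claim times; the condition on [arrival n w]
   says that exactly [n] claims have arrived at that time. *)
Let max_lossE (u : R) w : (u%:E < max_loss N (fun i => U i) w)%E <->
  exists n, arrival n w < \sum_(k < n.+1) W k w /\
    u < \sum_(i < n) U i w - arrival n w.
Proof.
have countP n t : 0 <= t -> arrival n w <= t -> t < \sum_(k < n.+1) W k w -> N t w = n.
  move=> t0 h1 h2; apply/eqP; rewrite eqn_leq N_count// -ltnS ltnNge N_count//.
  by rewrite -ltNge h2 (le_trans _ h1)// /arrival /pos le_max lexx orbT.
split=> [umax|[n [h1 h2]]].
  have /ereal_sup_gt[_ [t t0 <-] ut] := umax.
  rewrite /= in_itv/= andbT in t0; rewrite lte_fin in ut.
  exists (N t w).
  have h1 : arrival (N t w) w <= t.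
    by rewrite /arrival /pos ge_max t0 /= -N_count.
  have h2 : t < \sum_(k < (N t w).+1) W k w.
    by rewrite ltNge -N_count// ltnn.
  by split; [exact: le_lt_trans h1 h2|rewrite (lt_le_trans ut)// lerB].
have a0 : 0 <= arrival n w by exact: pos_ge0.
apply: (@lt_le_trans _ _ (\sum_(i < n) U i w - arrival n w)%:E).
  by rewrite lte_fin.
apply: ereal_sup_ubound; exists (arrival n w); first by rewrite /= in_itv/= a0.
by rewrite (countP n).
Qed.

(** [max_lossE] replaces the uncountable supremum over times by a countable union over claim
    numbers. *)
Lemma measurable_max_loss_gt (u : R) :
  measurable [set w | (u%:E < max_loss N (fun i => U i) w)%E].
Proof.
have -> : [set w | (u%:E < max_loss N (fun i => U i) w)%E] =
   \bigcup_n ((fun w => \sum_(k < n.+1) W k w - arrival n w) @^-1` [set x | 0 < x] `&`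
     (fun w => \sum_(i < n) U i w - arrival n w) @^-1` [set x | u < x]).
  rewrite predeqE => w; split=> [/max_lossE[n [h1 h2]]|[n _ [/= h1 h2]]].
    by exists n => //; split=> //=; rewrite subr_gt0.
  by apply/max_lossE; exists n; rewrite -subr_gt0.
apply: bigcupT_measurable => n; apply: measurableI.
- apply: measurable_preimage; last exact: measurable_ray_gt.
  by apply: measurable_funB => //; exact: measurable_sum.
- apply: measurable_preimage; last exact: measurable_ray_gt.
  by apply: measurable_funB => //; exact: measurable_sum.
Qed.

Lemma ruin_prob_walk (u : R) : ruin_prob P (max_loss N (fun i => U i)) u =
  fine (P (\bigcup_n [set w | u < walk_max U W 0 n w])).
Proof.
rewrite /ruin_prob; congr fine; apply: (probability_eq_off_null (Z := bad)) => //.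
- exact: measurable_max_loss_gt.
- apply: bigcupT_measurable => n.
  exact: (measurable_preimage (measurable_walk_max U W 0 n) (measurable_ray_gt u)).
move=> w nb.
have aE n : arrival n w = \sum_(k < n) W k w by rewrite /arrival pos_id// sum_ge0.
split=> [/max_lossE[n [h1 h2]]|[n _ /= h]].
  exists n => //=; apply: lt_le_trans (walk_max_ge 0 nb (leqnn n)).
  by rewrite sumrB -aE.
have [k kn kE] := walk_max_attained 0 n nb.
apply/max_lossE; exists k; split.
  (* The next waiting time must be strictly positive for the count to be exactly k at that time;
     this is why [bad] includes W k = 0. *)
  rewrite aE big_ord_recr/= ltrDl ltNge; apply/negP => h'.
  by apply: nb; exists k => //; left.
by rewrite aE -sumrB -kE.
Qed.

Variables (a b : R) (L S : probability R R).
Hypothesis lambda_ge0 : 0 <= lambda.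
Hypotheses (a0 : 0 <= a) (b0 : 0 <= b) (ab1 : a + b < 1).
Hypothesis expE : forall A, measurable A -> E A = exponential_prob lambda A.
Hypothesis L0 : survival L 0 = 1.
Hypothesis S0 : survival S 0 = 1.
Hypothesis truncF : forall x, 0 <= x ->
  lambda * \int[F]_y clip x y = a * (1 - survival L x) + b * (1 - survival S x).

Lemma ruin_prob_renewal :
  renewal_sol L S a b (ruin_prob P (max_loss N (fun i => U i))).
Proof.
rewrite (_ : ruin_prob _ _ = fun u =>
    fine (P (\bigcup_n [set w | u < walk_maxRV U W 0 n w]))); last first.
  by apply/funext => u; exact: ruin_prob_walk.
apply: (lindley_limit_renewal lambda_ge0 a0 b0 ab1 expE L0 S0 truncF).
- by move=> n w; exact: walk_max_ge0.
- by move=> w; exact: walk_max_nd.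
- by move=> n; exact: (walk_lindley_law rect_step).
Qed.

End model.

(** * Phase-type laws and stationary excess laws *)

(** There are finitely many states, so one h gives absorption with probability at least 1/2 from
    each of them; the semigroup property then halves the survival probability at every further h. *)
Lemma absorption_geometric (R : realType) (m : nat) (p : R -> 'M[R]_m.+1) :
  markov_transition p ->
  (forall t : R, 0 <= t -> p t ord_max ord_max = 1) ->
  (forall i, p t i ord_max @[t --> +oo] --> (1 : R)) ->
  exists2 h : R, 0 < h &
    forall n i, 1 - p (n%:R * h) i ord_max <= 2^-1 ^+ n.
Proof.
move=> [p_ge0 p_sum p0 p_semi _] p_abs p_lim.
have [h [h0 hP]] : exists h : R, 0 < h /\ forall i, 1 - p h i ord_max <= 2^-1.
  near (@pinfty_nbhs R) => h; exists h; split.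
    by near: h; apply: nbhs_pinfty_gt; exact: num_real.
  near: h; apply: filter_forall => i; near=> h.
  have : 2^-1 <= p h i ord_max.
    by near: h; apply: (cvgr_ge _ (p_lim i)); lra.
  by lra.
exists h => //; elim=> [|n IH] i.
  by rewrite mul0r expr0 lerBlDr lerDl p_ge0.
have nh0 : 0 <= n%:R * h by rewrite mulr_ge0// ltW.
rewrite -natr1 mulrDl mul1r [_ * h + h]addrC p_semi ?(ltW h0)// mxE.
rewrite -[X in X - _](p_sum h i (ltW h0)) -sumrB.
(* After the first h, the absorbing state contributes nothing and every other state at most the
   inductive bound. *)
apply: (@le_trans _ _ (\sum_j p h i j * ((j != ord_max)%:R * 2^-1 ^+ n))).
  apply: ler_sum => j _; rewrite -{1}[p h i j]mulr1 -mulrBr.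
  apply: ler_wpM2l; first exact/p_ge0/ltW.
  have [->|_] := eqVneq j ord_max; first by rewrite p_abs// subrr mul0r.
  by rewrite mul1r.
under eq_bigr do rewrite mulrA; rewrite -mulr_suml exprS.
apply: ler_wpM2r; first by rewrite exprn_ge0 ?invr_ge0.
apply: le_trans (hP i).
rewrite -[X in _ <= X - _](p_sum h i (ltW h0)).
rewrite [in leRHS](bigD1 ord_max)//= addrAC subrr add0r.
rewrite [leRHS]big_mkcond/=; apply: ler_sum => j _.
by case: eqP => _; rewrite /= ?mulr0 ?mulr1.
Unshelve. all: by end_near. Qed.

Lemma probability_partition d (T : measurableType d) (R : realType)
    (P : probability T R) (m : nat) (X : T -> 'I_m) (G : set T) :
  (forall i, measurable (X @^-1` [set i])) -> measurable G ->
  P G = (\sum_i P (X @^-1` [set i] `&` G))%E.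
Proof.
move=> mX mG.
rewrite -(@measure_bigsetU_ord _ _ _ P m xpredT (fun i => X @^-1` [set i] `&` G)).
- congr (P _); rewrite predeqE => w; split=> [Gw|].
    by rewrite (bigD1 (X w))//=; left.
  elim/big_rec: _ => //= i A _ IH [|//].
  by case.
- by move=> i; exact: measurableI.
- by move=> i j _ _ [w [[<- _] [<- _]]].
Qed.

(** Up to a null set, tau > t forces the process to be unabsorbed at t, an event whose probability
    is averaged over the initial state. *)
Lemma phase_type_tail d (T : measurableType d) (R : realType)
    (P : probability T R) (B : {RV P >-> R}) : phase_type P B ->
  exists2 h : R, 0 < h &
    forall n, survival (distribution P B) (n%:R * h) <= 2^-1 ^+ n.
Proof.
move=> [m [d' [T' [P' [p [X [tau [pM [p_abs p_lim] XM tauE law]]]]]]]].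
have [h h0 hP] := absorption_geometric pM p_abs p_lim.
have [mX _ fdd] := XM.
exists h => // n; set t := n%:R * h.
have t0 : 0 <= t by rewrite mulr_ge0// ltW.
have mXt i : measurable (X t @^-1` [set i]) by exact: mX.
have mX0 i : measurable (X 0 @^-1` [set i]) by exact: mX.
have q0 : 0 <= 2^-1 ^+ n :> R by rewrite exprn_ge0// invr_ge0.
pose G := ~` (X t @^-1` [set ord_max]).
have mG : measurable G by exact: measurableC.
have joint i : P' (X 0 @^-1` [set i] `&` X t @^-1` [set ord_max]) =
    (P' (X 0%R @^-1` [set i]) * (p t i ord_max)%:E)%E.
  have := fdd 1%N (fun k => if k is 0%N then 0 else t)
    (fun k => if k is 0%N then i else ord_max) erefl.
  rewrite big_ord_recl big_ord0 mulr1 /= subr0 => <-; last by case.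
  congr (P' _); rewrite predeqE => w; split=> [[/= h1 h2] [|[|k]]//|hk].
  by split; [exact: (hk 0%N)|exact: (hk 1%N)].
have PG : (P' G <= (2^-1 ^+ n)%:E)%E.
  rewrite (probability_partition (X := X 0) P')//.
  apply: (@le_trans _ _ (\sum_i P' (X 0%R @^-1` [set i]) * (2^-1 ^+ n)%:E)%E).
    apply: lee_sum => i _.
    set A := X 0 @^-1` [set i]; set D := X t @^-1` [set ord_max].
    have mA : measurable A by exact: mX0.
    have mAD : measurable (A `&` D) by apply: measurableI => //; exact: mXt.
    have -> : P' (A `&` G) = (P' A - P' (A `&` D))%E.
      have -> : A `&` G = A `\` (A `&` D) by rewrite setDIr setDv set0U setDE.
      rewrite measureD//; last first.
        by apply: (le_lt_trans (probability_le1 P' mA)); rewrite ltry.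
      by rewrite setIA setIid.
    rewrite joint -(@fineK _ (P' A)) ?fin_num_measure//.
    rewrite -!EFinM -EFinB lee_fin -{1}[fine _]mulr1 -mulrBr.
    by rewrite ler_wpM2l ?fine_ge0// hP.
  rewrite -ge0_sume_distrl//.
  have := probability_partition (X := X 0) P' mX0 measurableT.
  rewrite probability_setT; under eq_bigr do rewrite setIT.
  by move=> <-; rewrite mul1e.
have mgt := @measurable_ray_gt R t.
have : (P (B @^-1` [set x | (t < x)%R]) <= (2^-1 ^+ n)%:E)%E.
  rewrite law//; apply: le_trans PG.
  have [Z [mZ Z0 hZ]] := tauE.
  apply: (@le_trans _ _ (P' (G `|` Z))).
    rewrite le_measure ?inE//; [exact: measurable_preimage|exact: measurableU|].
    move=> w /= tw; have [zw|nz] := pselect (Z w); [by right|left => Xt].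
    apply: nz; apply: hZ => /= tE.
    have : (ereal_inf [set s%:E | s in
        [set s : R | (0 <= s)%R /\ X s w = ord_max]] <= t%:E)%E.
      by apply: ereal_inf_lbound; exists t.
    by rewrite -tE lee_fin leNgt tw.
  have -> : P' G = (P' G + P' Z)%E by rewrite Z0 adde0.
  exact: measureU2.
rewrite -[X in (X <= _)%E -> _]fineK; last first.
  by apply: fin_num_measure; exact: measurable_preimage.
by rewrite lee_fin.
Qed.

(** * Stationary excess laws and their size against a subexponential tail *)

Section excess.
Context d (T : measurableType d) (R : realType) (P : probability T R).
Variables (X Xe : {RV P >-> R}).
Hypothesis X_mean : (0 < 'E_P[X] < +oo)%E.
Hypothesis Xe_law : stationary_excess X Xe.

Let mean := fine ('E_P[X])%E.

Lemma mean_gt0 : 0 < mean.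
Proof. by apply: fine_gt0. Qed.

Lemma cdf_tail (Y : {RV P >-> R}) (u : R) :
  fine (cdf Y u) = 1 - survival (distribution P Y) u.
Proof.
rewrite survival_cdf opprB addrC subrK /cdf; congr fine.
Qed.

Lemma excess_trunc (u : R) : 0 <= u ->
  mean * (1 - survival (distribution P Xe) u) = \int[distribution P X]_y clip u y.
Proof.
move=> u0; rewrite -cdf_tail Xe_law// -/mean mulrA divff ?mul1r; last first.
  by rewrite gt_eqF// mean_gt0.
rewrite Rintegral_trunc//; apply: eq_Rintegral => t _.
by rewrite cdf_tail opprB addrC subrK.
Qed.

Lemma excess_tail0 : survival (distribution P Xe) 0 = 1.
Proof.
have := excess_trunc (lexx 0).
rewrite (_ : \int[_]_y _ = 0); last first.
  rewrite Rintegral_trunc// set_itv1.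
  by rewrite /Rintegral integral_set1.
move/eqP; rewrite mulf_eq0 gt_eqF ?mean_gt0//= subr_eq0 => /eqP.
by [].
Qed.

Lemma excess_lt0 : distribution P Xe [set x | x < 0] = 0%E.
Proof.
have := excess_tail0; rewrite survival_cdf => /eqP.
rewrite subr_eq addrC -subr_eq subrr eq_sym => /eqP h.
have ml := @measurable_ray_lt R 0; have me := @measurable_ray_le R 0.
apply/eqP; rewrite eq_le measure_ge0 andbT.
apply: (@le_trans _ _ (distribution P Xe [set x | x <= 0])).
  by rewrite le_measure ?inE// => x /= /ltW.
by rewrite -(@fineK _ (distribution P Xe [set x | x <= 0])) ?fin_num_measure// h.
Qed.

(** The difference of the truncations at v and at u is at most v - u, and it vanishes for values up
    to u. *)
Lemma excess_diff (u v : R) : 0 <= u -> u <= v ->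
  mean * (survival (distribution P Xe) u - survival (distribution P Xe) v) <=
  (v - u) * survival (distribution P X) u.
Proof.
move=> u0 uv; have v0 := le_trans u0 uv.
have -> : mean * (survival (distribution P Xe) u - survival (distribution P Xe) v) =
    \int[distribution P X]_y (clip v y - clip u y).
  rewrite RintegralB//; last 2 first.
  - exact/bounded_meas_integrable/bounded_meas_trunc.
  - exact/bounded_meas_integrable/bounded_meas_trunc.
  by rewrite -!excess_trunc//; ring.
have mg := measurable_ray_gt u.
have bi : bounded_meas (\1_[set y : R | u < y] : R -> R) by exact: bounded_meas_indic.
have -> : (v - u) * survival (distribution P X) u =
    \int[distribution P X]_y ((v - u) * \1_[set y : R | u < y] y).
  rewrite RintegralZl//; last exact: bounded_meas_integrable.
  by rewrite Rintegral_indic.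
apply: le_Rintegral => //.
- apply: bounded_meas_integrable; apply: bounded_measB; exact: bounded_meas_trunc.
- exact/bounded_meas_integrable/bounded_measZ.
move=> y _; rewrite indicE.
have [yu|uy] := lerP y u.
  rewrite memNset/= ?mulr0; last by rewrite /= ltNge yu.
  have [y0|/ltW y0] := lerP y 0; first by rewrite !clip_neg// subrr.
  by rewrite !clip_id ?subrr// (le_trans yu).
rewrite mem_set//= mulr1 (clip_max u0 (ltW uy)).
have [yv|vy] := lerP y v.
  by rewrite clip_id ?lerB// (le_trans u0)// ltW.
by rewrite (clip_max v0 (ltW vy)).
Qed.

Variable h : R.
Hypothesis h_gt0 : 0 < h.
Hypothesis X_tail : forall n, survival (distribution P X) (n%:R * h) <= 2^-1 ^+ n.

Lemma excess_geometric n :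
  survival (distribution P Xe) (n%:R * h) <= 2 * h / mean * 2^-1 ^+ n.
Proof.
have m0 := mean_gt0; have h0 := h_gt0.
(* By [excess_diff] the excess mass between kh and (k + 1)h is at most h / mean 2^-k, and these
   bounds sum over k >= n to c 2^-n. The sum is expressed through [D], which is nondecreasing with
   limit 0 and therefore nonpositive. *)
pose c := 2 * h / mean.
pose D k := survival (distribution P Xe) (k%:R * h) - c * 2^-1 ^+ k.
have Dnd : nondecreasing_seq D.
  apply/nondecreasing_seqP => k; rewrite /D.
  have k0 : 0 <= k%:R * h by rewrite mulr_ge0// ltW.
  have kk : k%:R * h <= k.+1%:R * h by rewrite ler_wpM2r ?ler_nat ?ltW.
  have := excess_diff k0 kk.
  have -> : k.+1%:R * h - k%:R * h = h by rewrite -natr1; ring.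
  have := X_tail k; set q := 2^-1 ^+ k => Xk Hd.
  have : survival (distribution P Xe) (k%:R * h) -
      survival (distribution P Xe) (k.+1%:R * h) <= h * q / mean.
    rewrite ler_pdivlMr// mulrC (le_trans Hd)// ler_wpM2l// ltW//.
  rewrite exprS -/q (_ : c * (2^-1 * q) = c * q - h * q / mean); last first.
    by rewrite /c; field; rewrite gt_eqF.
  move=> Hk; rewrite -subr_ge0; rewrite -subr_ge0 in Hk.
  by apply: le_trans Hk _; rewrite le_eqVlt; apply/orP; left; apply/eqP; ring.
have hn : (fun k : nat => k%:R * h) @ \oo --> +oo.
  apply/cvgryPge => A; near=> k; rewrite -ler_pdivrMr//.
  by near: k; exact: nbhs_infty_ger.
have D0 : D k @[k --> \oo] --> 0 - c * 0.
  apply: cvgB; first exact: (cvg_comp _ _ hn (@survival_cvg0 _ _)).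
  apply: cvgM; first exact: cvg_cst.
  by apply: cvg_expr; rewrite ger0_norm ?invr_ge0// invf_lt1 ?ltr1n.
rewrite mulr0 subr0 in D0.
have Dc : cvgn D by apply/cvg_ex; exists 0.
have := nondecreasing_cvgn_le Dnd Dc n.
by rewrite (cvg_lim _ D0)// /D subr_le0.
Unshelve. all: by end_near. Qed.

Variable S : probability R R.
Hypothesis Ssub : subexponential S.

Lemma subexp_tail_geometric : exists2 c : R, 0 < c &
  forall n, c * (3 / 4) ^+ n <= survival S (n%:R * h).
Proof.
have h0 := h_gt0.
(* A quotient of at most 4/3 over a step h means that the tail keeps at least 3/4 of itself, which
   exceeds the 1/2 of [excess_geometric]. *)
have /cvgrPdist_le/(_ (1/3) ltac:(lra)) [M [_ HM]] := subexp_long_tailed Ssub (ltW h0).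
have [n0 n0M] : exists n0 : nat, M < n0%:R * h.
  exists (Num.truncn (M / h)).+1; rewrite -ltr_pdivrMr//; exact: truncnS_gt.
have step k : (3 / 4) * survival S ((n0 + k)%N%:R * h) <= survival S ((n0 + k).+1%:R * h).
  have Mk : M < (n0 + k).+1%:R * h.
    by apply: lt_le_trans n0M _; rewrite ler_wpM2r ?ler_nat ?(ltW h0)// leqW// leq_addr.
  have := HM _ Mk; rewrite -natr1 mulrDl mul1r addrK.
  have s0 := subexp_tail_gt0 Ssub ((n0 + k)%N%:R * h + h).
  rewrite ler_norml => /andP[+ _].
  rewrite lerBrDl -lerBrDr opprK ler_pdivrMr//; lra.
have t0 := subexp_tail_gt0 Ssub (n0%:R * h).
have up k : survival S (n0%:R * h) * (3 / 4) ^+ k <= survival S ((n0 + k)%N%:R * h).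
  elim: k => [|k IH]; first by rewrite expr0 mulr1 addn0.
  rewrite addnS; apply: le_trans (step k); rewrite exprS mulrCA ler_wpM2l//; lra.
exists (survival S (n0%:R * h)) => // n.
have [nn|nn] := leqP n0 n.
  rewrite -(subnKC nn); apply: le_trans (up _).
  rewrite ler_wpM2l ?(ltW t0)// exprD.
  have q0 : 0 <= 3 / 4 :> R by lra.
  have q1 : 3 / 4 <= 1 :> R by lra.
  by apply: ler_piMl; [exact: exprn_ge0|exact: exprn_ile1].
apply: (@le_trans _ _ (survival S (n0%:R * h))).
  by rewrite ler_piMr ?(ltW t0)// exprn_ile1//; lra.
by rewrite survival_nonincr// ler_wpM2r ?(ltW h0)// ler_nat ltnW.
Qed.

Lemma excess_ratio0 :
  survival (distribution P Xe) u / survival S u @[u --> +oo] --> (0 : R).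
Proof.
have m0 := mean_gt0; have h0 := h_gt0.
have [c c0 Hc] := subexp_tail_geometric.
(* For u between nh and (n + 1)h, the excess tail is bounded at nh and the tail of S at (n + 1)h,
   whence the extra 3/4; the ratio 2/3 below is 1/2 over 3/4. *)
pose K := 2 * h / mean / (c * (3 / 4)).
apply/cvgrPdist_le => e e0.
have : K * (2/3) ^+ n @[n --> \oo] --> K * 0.
  apply: cvgM; first exact: cvg_cst.
  by apply: cvg_expr; rewrite ger0_norm; lra.
rewrite mulr0 => /cvgr_le/(_ _ e0)[n1 _ Hn1].
near=> u.
have u0 : 0 <= u by near: u; apply: nbhs_pinfty_ge; exact: num_real.
have un : n1%:R * h <= u by near: u; apply: nbhs_pinfty_ge; exact: num_real.
have s0 := subexp_tail_gt0 Ssub u.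
rewrite sub0r normrN ger0_norm ?divr_ge0 ?survival_ge0//.
pose n := Num.truncn (u / h).
have uh0 : 0 <= u / h by rewrite divr_ge0// ltW.
have /andP[nu un1] := truncn_itv uh0.
have n1n : (n1 <= n)%N by rewrite truncn_ge_nat// ler_pdivlMr.
apply: le_trans (Hn1 n n1n).
rewrite ler_pdivrMr//.
have t1 : survival (distribution P Xe) u <= 2 * h / mean * 2^-1 ^+ n.
  apply: le_trans (excess_geometric n); apply: survival_nonincr.
  by rewrite -ler_pdivlMr.
have t2 : c * (3 / 4) ^+ n.+1 <= survival S u.
  apply: le_trans (Hc n.+1) _; apply: survival_nonincr.
  by rewrite ltW// -ltr_pdivrMr.
apply: (le_trans t1).
have q0 : 0 <= K * (2 / 3) ^+ n.
  by rewrite mulr_ge0 ?exprn_ge0 ?divr_ge0 ?mulr_ge0 ?ltW//; lra.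
apply: le_trans (ler_wpM2l q0 t2).
rewrite le_eqVlt; apply/orP; left; apply/eqP.
have -> : (2^-1 : R) = (2 / 3) * (3 / 4) by field.
rewrite exprMn exprS /K; field.
by rewrite !gt_eqF.
Unshelve. all: by end_near. Qed.

End excess.

(** * The ruin probability and its approximation *)

Section risk_model_renewal.
Context (R : realType) d (T : measurableType d) (P : probability T R).
Variables (lambda eps delta theta : R) (B C Be Ce : {RV P >-> R}).
Variables (N : R -> T -> nat) (U : nat -> {RV P >-> R}).
Hypotheses (lambda_gt0 : 0 < lambda) (eps01 : 0 <= eps <= 1).
Hypotheses (B_ge0 : forall w, 0 <= B w) (C_ge0 : forall w, 0 <= C w).
Hypotheses (B_mean : (0 < 'E_P[B] < +oo)%E) (C_mean : (0 < 'E_P[C] < +oo)%E).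
Hypothesis delta_def : delta = lambda * fine ('E_P[B])%E.
Hypothesis theta_def : theta = lambda * fine ('E_P[C])%E.
Hypothesis rho_lt1 : (1 - eps) * delta + eps * theta < 1.
Hypotheses (Be_law : stationary_excess B Be) (Ce_law : stationary_excess C Ce).
Hypothesis model : risk_model lambda eps B C N U.

Let F := distribution P (U 0%N).

Let survival_mix t : survival F t =
  (1 - eps) * survival (distribution P B) t + eps * survival (distribution P C) t.
Proof.
have [_ _ Ulaw _] := model; have mt := measurable_ray_gt t.
have -> : survival F t = fine (P (U 0%N @^-1` [set x | t < x])) by [].
rewrite /survival Ulaw//.
have fin (X : {RV P >-> R}) : P (X @^-1` [set x | t < x]) \is a fin_num.
  by apply: fin_num_measure; exact: measurable_preimage.
by rewrite fineD ?fin_numM ?fin// !fineM ?fin.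
Qed.

Lemma claim_trunc x : 0 <= x -> lambda * \int[F]_y clip x y =
  (1 - eps) * delta * (1 - survival (distribution P Be) x) +
  eps * theta * (1 - survival (distribution P Ce) x).
Proof.
move=> x0; rewrite Rintegral_trunc//.
under eq_Rintegral do rewrite survival_mix.
have iB := integrable_tail (distribution P B) x.
have iC := integrable_tail (distribution P C) x.
rewrite RintegralD//.
- rewrite !RintegralZl// -!Rintegral_trunc//.
  rewrite -(excess_trunc B_mean Be_law)// -(excess_trunc C_mean Ce_law)//.
  by rewrite delta_def theta_def; ring.
- rewrite (_ : EFin \o _ =
    fun t => ((1 - eps)%:E * (survival (distribution P B) t)%:E)%E)//.
  exact: integrableZl.
- rewrite (_ : EFin \o _ =
    fun t => (eps%:E * (survival (distribution P C) t)%:E)%E)//.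
  exact: integrableZl.
Qed.

Lemma load_ge0 : 0 <= (1 - eps) * delta /\ 0 <= eps * theta.
Proof.
have /andP[e0 e1] := eps01.
have b := mean_gt0 B_mean; have c := mean_gt0 C_mean.
rewrite delta_def theta_def; split.
  by rewrite mulr_ge0 ?subr_ge0// mulr_ge0// ltW.
by rewrite mulr_ge0// mulr_ge0// ltW.
Qed.

Lemma risk_model_renewal :
  renewal_sol (distribution P Be) (distribution P Ce)
    ((1 - eps) * delta) (eps * theta) (ruin_prob P (max_loss N U)) /\
  forall u : R, measurable [set w | (u%:E < max_loss N U w)%E].
Proof.
have [[W [Windep Wlaw Ncount]] Uindep Ulaw NU] := model.
have [a0 b0] := load_ge0.
pose E := distribution P (W 0%N).
have expE A : measurable A -> E A = exponential_prob lambda A by exact: Wlaw.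
have WlawE k A : measurable A -> P (W k @^-1` A) = E A.
  by move=> mA; rewrite expE// Wlaw.
have UlawF i A : measurable A -> P (U i @^-1` A) = F A.
  move=> mA; have -> : F A = P (U 0%N @^-1` A) by [].
  by rewrite !Ulaw.
have E0 : survival E 0 = 1 by rewrite (exp_tail expE)// mulr0 expR0.
have F0 : F [set x | x < 0] = 0%E.
  have -> : F [set x | x < 0] = P (U 0%N @^-1` [set x | x < 0]) by [].
  rewrite Ulaw; last exact: measurable_ray_lt.
  have z (X : {RV P >-> R}) : (forall w, 0 <= X w) -> X @^-1` [set x | x < 0] = set0.
    by move=> X0; rewrite -subset0 => w /=; rewrite ltNge X0.
  by rewrite !z// measure0 !mule0 adde0.
split; last by move=> u; exact: (measurable_max_loss_gt U Ncount u).
exact: (ruin_prob_renewal Windep WlawE E0 Ncount Uindep UlawF F0 NU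
  (ltW lambda_gt0) a0 b0 rho_lt1 expE (excess_tail0 B_mean Be_law)
  (excess_tail0 C_mean Ce_law) claim_trunc).
Qed.

End risk_model_renewal.

(** * Tails of sums of independent variables *)

Section sums.
Context d (T : measurableType d) (R : realType) (P : probability T R).

Lemma product_tail (Q1 Q2 : probability R R) (u : R) :
  fine ((Q1 \x Q2)%E [set z : R * R | u < z.1 + z.2]) = convolve Q2 (survival Q1) u.
Proof.
rewrite conv_tailC /convolve /Rintegral; congr fine.
apply: eq_integral => x _.
rewrite /survival fineK; last by apply: fin_num_measure; exact: measurable_ray_gt.
congr (Q2 _); rewrite predeqE => y; rewrite /xsection /= inE /=.
by split; lra.
Qed.

Lemma measurable_sum_gt (u : R) : measurable [set z : R * R | u < z.1 + z.2].
Proof.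
have ms : measurable_fun setT (fun z : R * R => z.1 + z.2) by exact: measurable_funD.
exact: (measurable_preimage ms (measurable_ray_gt u)).
Qed.

Lemma indep3_sum_tail (X Y Z : {RV P >-> R}) (u : R) :
  (forall A B C, measurable A -> measurable B -> measurable C ->
    P (X @^-1` A `&` Y @^-1` B `&` Z @^-1` C) =
    (P (X @^-1` A) * P (Y @^-1` B) * P (Z @^-1` C))%E) ->
  fine (P [set w | u < X w + Y w + Z w]) =
  convolve (distribution P Z) (convolve (distribution P Y) (survival (distribution P X))) u.
Proof.
move=> ind.
have mX : measurable_fun setT X by [].
have mY : measurable_fun setT Y by [].
have mXY : measurable_fun setT (fun w => X w + Y w) by exact: measurable_funD.
pose XY : {RV P >-> R} :=
  HB.pack (fun w => X w + Y w) (isMeasurableFun.Build _ _ _ _ _ mXY).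
pose dX := distribution P X; pose dY := distribution P Y.
pose dZ := distribution P Z.
have pairXY C K : measurable C -> measurable K ->
    P ((fun w => (X w, Y w)) @^-1` K `&` Z @^-1` C) =
    ((dX \x dY) K * P (Z @^-1` C))%E.
  move=> mC mK; apply: indep_pair_event => //; first exact: measurable_preimage.
  by move=> A B mA mB; rewrite ind.
have pairXYT K : measurable K -> P ((fun w => (X w, Y w)) @^-1` K) = (dX \x dY)%E K.
  move=> mK; have := pairXY setT K measurableT mK.
  by rewrite preimage_setT setIT probability_setT mule1.
have mplus : measurable_fun setT (fun z : R * R => z.1 + z.2) by exact: measurable_funD.
have pairZ K : measurable K ->
    P ((fun w => (XY w, Z w)) @^-1` K) = ((distribution P XY \x dZ) K)%E.
  move=> mK.
  have := @indep_pair_event _ _ _ T _ _ _ P (distribution P XY) dZ XY Z setT.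
  move=> /(_ _ _ measurableT _ K mK); rewrite setIT probability_setT mule1.
  apply=> // A C mA mC; rewrite setIT mule1.
  have mA' := measurable_preimage mplus mA.
  rewrite -[XY @^-1` A]/((fun w => (X w, Y w)) @^-1`
    ((fun z : R * R => z.1 + z.2) @^-1` A)).
  rewrite pairXY//; congr (_ * _)%E.
  by rewrite -pairXYT.
have -> : [set w | u < X w + Y w + Z w] =
    (fun w => (XY w, Z w)) @^-1` [set z : R * R | u < z.1 + z.2] by [].
rewrite pairZ; last exact: measurable_sum_gt.
rewrite product_tail; congr (convolve _ _ _); apply/funext => v.
rewrite -product_tail -pairXYT//; exact: measurable_sum_gt.
Qed.

End sums.

Section unit_functions.
Context (R : realType).
Implicit Types Q : probability R R.

Lemma unit_fun_conv Q f : Q [set x | x < 0] = 0%E -> unit_fun f ->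
  unit_fun (convolve Q f).
Proof.
move=> Q0 uf; have bf := unit_fun_bounded uf; have [mf f01 fn] := uf.
have f0 x : 0 <= f x by case/andP: (f01 x).
split; first by case: (bounded_meas_conv Q bf f0).
  by move=> u; exact: conv_ge0_le1.
move=> u u0; apply/eqP; rewrite eq_le.
have /andP[_ ->] /= := conv_ge0_le1 Q u bf f01.
rewrite -(survival_lt0 Q0 u0) -[u in survival Q u]subr0 -conv_ray_lt ler_conv//.
  by apply: bounded_meas_indic; exact: measurable_ray_lt.
move=> x; rewrite indic_ray_lt; have [x0|_] /= := ltP x 0; last exact: f0.
by rewrite fn.
Qed.

Lemma survival_eq1_lt0 Q :
  (forall u, u < 0 -> survival Q u = 1) -> Q [set x | x < 0] = 0%E.
Proof.
move=> Q1.
have -> : [set x : R | x < 0] = \bigcup_n [set x | x <= - n.+1%:R^-1].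
  rewrite predeqE => x; split=> [/= x0|[n _ /= h]]; last first.
    by apply: le_lt_trans h _; rewrite oppr_lt0 invr_gt0.
  exists (Num.truncn (- x)^-1) => //=.
  rewrite lerNr invf_ple ?posrE ?ltr0Sn ?oppr_gt0//.
  exact/ltW/truncnS_gt.
apply: measure_negligible.
  by apply: bigcupT_measurable => n; exact: measurable_ray_le.
apply: negligible_bigcup => n; apply/negligibleP; first exact: measurable_ray_le.
have : survival Q (- n.+1%:R^-1) = 1 by apply: Q1; rewrite oppr_lt0 invr_gt0.
rewrite survival_cdf => /eqP; rewrite subr_eq addrC -subr_eq subrr eq_sym => /eqP h.
have mr := @measurable_ray_le R (- n.+1%:R^-1).
by apply/eqP; rewrite -fine_eq0 ?fin_num_measure// h.
Qed.

Lemma tail0_mass Q : survival Q 0 = 1 -> exists2 eta : R, 0 < eta & 0 < survival Q eta.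
Proof.
move=> Q1; apply: contrapT => H.
have z n : survival Q n.+1%:R^-1 = 0.
  apply/eqP; rewrite eq_le survival_ge0 andbT leNgt; apply/negP => h.
  by apply: H; exists n.+1%:R^-1.
have : Q [set x | 0 < x] = 0%E.
  have -> : [set x : R | 0 < x] = \bigcup_n [set x | n.+1%:R^-1 < x].
    rewrite predeqE => x; split=> [/= x0|[n _ /= h]]; last exact: lt_trans h.
    exists (Num.truncn x^-1) => //=.
    rewrite invf_plt ?posrE//; exact: truncnS_gt.
  apply: measure_negligible.
    by apply: bigcupT_measurable => n; exact: measurable_ray_gt.
  apply: negligible_bigcup => n; apply/negligibleP; first exact: measurable_ray_gt.
  have mr := @measurable_ray_gt R n.+1%:R^-1.
  by apply/eqP; rewrite -fine_eq0 ?fin_num_measure//; apply/eqP; exact: z.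
by move=> Q0; move: Q1; rewrite /survival Q0 /= => /eqP; rewrite eq_sym oner_eq0.
Qed.

(** A jump of law L exceeds eta with weight c = a * survival L eta > 0, and n such jumps pass every
    level below n * eta. At epsilon = 0 this permits division by the ruin probability. *)
Lemma renewal_sol_gt0 (L S : probability R R) (a b : R) f u :
  0 < a -> 0 <= b -> a <= 1 -> survival L 0 = 1 -> renewal_sol L S a b f -> 0 < f u.
Proof.
move=> a0 b0 a1 L1 [uf fE]; have bf := unit_fun_bounded uf; have [_ f01 fn] := uf.
have [eta eta0 Leta] := tail0_mass L1.
pose c := a * survival L eta.
have c0 : 0 < c by rewrite mulr_gt0.
have c1 : c <= 1 by rewrite mulr_ile1 ?survival_ge0 ?survival_le1// ltW.
have lower n v : v < n%:R * eta -> c ^+ n <= f v.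
  elim: n v => [|n IH] v; first by rewrite mul0r => /fn ->; rewrite expr0.
  move=> vn; have [v0|v0] := ltP v 0.
    by rewrite fn// exprn_ile1// ltW.
  have cn0 : 0 <= c ^+ n by rewrite exprn_ge0// ltW.
  rewrite fE// /mixconv.
  have bi : bounded_meas (\1_[set x : R | x < v - eta] : R -> R).
    by apply: bounded_meas_indic; exact: measurable_ray_lt.
  have h1 : c ^+ n * survival L eta <= convolve L f v.
    have -> : c ^+ n * survival L eta =
        convolve L (fun x => c ^+ n * \1_[set x : R | x < v - eta] x) v.
      by rewrite convZ// conv_ray_lt subKr.
    apply: ler_conv => //; first exact: bounded_measZ.
    move=> x; rewrite indic_ray_lt; have [xv|_] /= := ltP x (v - eta).
      rewrite mulr1 IH//; move: vn xv; rewrite -natr1; lra.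
    by rewrite mulr0; case/andP: (f01 x).
  have h2 : 0 <= convolve S f v by case/andP: (conv_ge0_le1 S v bf f01).
  rewrite exprS /c -mulrA [survival L eta * _]mulrC -[leLHS]addr0 lerD// ?mulr_ge0//.
  by rewrite ler_wpM2l// ltW.
pose n := (Num.truncn (u / eta)).+1.
apply: lt_le_trans (lower n u _); first exact: exprn_gt0.
by rewrite -ltr_pdivrMr// truncnS_gt.
Qed.

End unit_functions.

(** * Almost sure finiteness of the copies of the maximum *)

Section extended.
Context d (T : measurableType d) (R : realType) (P : probability T R).

Lemma measurable_egt (u : R) : measurable [set x : \bar R | (u%:E < x)%E].
Proof.
have := @emeasurable_itv R `]u%:E, +oo[.
by rewrite set_itvE.
Qed.

Definition fineRV (M : {RV P >-> \bar R}) : {RV P >-> R} :=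
  HB.pack (fun w => fine (M w)) (isMeasurableFun.Build _ _ _ _ _
    (measurableT_comp (@fine_measurable R setT measurableT)
      (@measurable_funPT _ _ _ _ M))).

Variables (M : {RV P >-> \bar R}) (psi : R -> R).
Hypothesis M_tail : forall u, fine (P [set w | (u%:E < M w)%E]) = psi u.
Hypothesis psi_cvg0 : psi u @[u --> +oo] --> (0 : R).
Hypothesis psi_lt0 : forall u, u < 0 -> psi u = 1.

Let nonfin : set T := [set w | M w \isn't a fin_num].

Let mgt u : measurable [set w | (u%:E < M w)%E].
Proof.
exact: (measurable_preimage (@measurable_funPT _ _ _ _ M) (measurable_egt u)).
Qed.

Lemma measurable_nonfin : measurable nonfin.
Proof.
have -> : nonfin = (M @^-1` [set +oo%E]) `|` (M @^-1` [set -oo%E]).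
  rewrite predeqE => w; rewrite /nonfin /=; split.
    by case: (M w) => //; [left|right].
  by case=> ->.
by apply: measurableU; apply: measurable_preimage => //; exact: emeasurable_set1.
Qed.

(** The value +oo is excluded by the limit 0 of [psi], and -oo by [psi (-1) = 1]. *)
Lemma nonfin0 : P nonfin = 0%E.
Proof.
have mN := measurable_nonfin.
apply/eqP; rewrite -fine_eq0 ?fin_num_measure//.
rewrite eq_le fine_ge0 ?measure_ge0// andbT.
apply/ler_addgt0Pl => e e0; rewrite addr0.
near (@pinfty_nbhs R) => u.
have pu : psi u <= e by near: u; exact: (cvgr_le _ psi_cvg0).
apply: le_trans pu; rewrite -M_tail.
have mm : measurable (~` [set w | ((-1)%:E < M w)%E]) by exact: measurableC.
have P0 : P (~` [set w | ((-1)%:E < M w)%E]) = 0%E.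
  rewrite probability_setC// -(@fineK _ (P [set w | _])) ?fin_num_measure//.
  by rewrite M_tail psi_lt0 ?ltrN10// subee.
(* Adjoining the null event M <= -1 makes the event contain all nonfinite values. *)
have -> : P [set w | (u%:E < M w)%E] =
   P ([set w | (u%:E < M w)%E] `|` ~` [set w | ((-1)%:E < M w)%E]).
  apply: (probability_eq_off_null (Z := ~` [set w | ((-1)%:E < M w)%E])) => //.
    exact: measurableU.
  by move=> w nz; split=> [|[]]; [left| |].
apply: fine_probability_le => //; first exact: measurableU.
move=> w; rewrite /nonfin /=; case: (M w) => //= _.
  by left; rewrite ltry.
by right; rewrite ltNge leNye.
Unshelve. all: by end_near. Qed.

Lemma survival_fineRV : survival (distribution P (fineRV M)) = psi.
Proof.
apply/funext => u; rewrite -M_tail.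
have -> : survival (distribution P (fineRV M)) u =
    fine (P [set w | u < fine (M w)]) by [].
congr fine; apply: (probability_eq_off_null (Z := nonfin)).
- exact: (measurable_preimage (@measurable_funPT _ _ _ _ (fineRV M))
    (measurable_ray_gt u)).
- exact: mgt.
- exact: measurable_nonfin.
- exact: nonfin0.
move=> w /=; rewrite /nonfin /= => /negP; rewrite negbK => Mf.
by rewrite -{2}(fineK Mf) lte_fin.
Qed.

End extended.

Lemma mutually_independent3 d (T : measurableType d) (R : realType)
    (P : probability T R) (I : eqType) (G : I -> set_system T) (i j k : I)
    (A B C : set T) :
  mutually_independent P G -> uniq [:: i; j; k] -> G i A -> G j B -> G k C ->
  P (A `&` B `&` C) = (P A * P B * P C)%E.
Proof.
move=> ind; rewrite /= !inE negb_or => /andP[/andP[ij ik] /andP[jk _]] GA GB GC.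
pose D l := if l == i then A else if l == j then B else C.
have Di : D i = A by rewrite /D eqxx.
have Dj : D j = B by rewrite /D eq_sym (negbTE ij) eqxx.
have Dk : D k = C by rewrite /D ![k == _]eq_sym (negbTE ik) (negbTE jk).
have := ind [:: i; j; k] D.
rewrite !big_cons big_nil mule1 Di Dj Dk muleA /= !inE negb_or ij ik jk.
move=> /(_ isT) <-.
  congr (P _); rewrite predeqE => w; split=> [[[wA wB] wC] l|h].
    by rewrite /= !inE => /or3P[] /eqP ->; rewrite ?Di ?Dj ?Dk.
  split; first split.
  - by rewrite -Di; apply: h; rewrite /= !inE eqxx.
  - by rewrite -Dj; apply: h; rewrite /= !inE eqxx orbT.
  - by rewrite -Dk; apply: h; rewrite /= !inE eqxx !orbT.
by move=> l; rewrite !inE => /or3P[] /eqP ->; rewrite ?Di ?Dj ?Dk.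
Qed.

Lemma sigma_rv_fine d (T : measurableType d) (R : realType)
    (P : probability T R) (M : {RV P >-> \bar R}) (A : set R) :
  measurable A -> sigma_rv M (fineRV M @^-1` A).
Proof.
move=> mA; exists (fine @^-1` A); last by rewrite setTI.
exact: (measurable_preimage (@fine_measurable R setT measurableT) mA).
Qed.

Lemma sigma_rv_preimage d (T : measurableType d) (R : realType)
    (P : probability T R) (X : {RV P >-> R}) (A : set R) :
  measurable A -> sigma_rv X (X @^-1` A).
Proof. by move=> mA; exists A => //; rewrite setTI. Qed.

(** * Asymptotics of the approximation and of its relative error *)

Section main.
Context (R : realType) d (T : measurableType d) (P : probability T R).
Variables (lambda eps delta theta rho : R).
Variables (B C : {RV P >-> R}) (N N0 : R -> T -> nat).
Variables (U U0 : nat -> {RV P >-> R}) (M00 M01 : {RV P >-> \bar R}).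
Variables (Ce Be : {RV P >-> R}).
Hypotheses (lambda_gt0 : 0 < lambda) (eps_ge0 : 0 <= eps) (eps_le1 : eps <= 1).
Hypotheses (B_ge0 : forall w, 0 <= B w) (C_ge0 : forall w, 0 <= C w).
Hypothesis B_phase_type : phase_type P B.
Hypotheses (B_mean : (0 < 'E_P[B] < +oo)%E) (C_mean : (0 < 'E_P[C] < +oo)%E).
Hypothesis delta_def : delta = lambda * fine ('E_P[B])%E.
Hypothesis theta_def : theta = lambda * fine ('E_P[C])%E.
Hypothesis rho_def : rho = (1 - eps) * delta + eps * theta.
Hypotheses (rho_lt1 : rho < 1) (delta_lt1 : delta < 1).
Hypothesis model : risk_model lambda eps B C N U.
Hypothesis base_model : risk_model lambda 0 B C N0 U0.
Hypothesis M00_law : same_law P P M00 (max_loss N0 U0).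
Hypothesis M01_law : same_law P P M01 (max_loss N0 U0).
Hypotheses (Ce_law : stationary_excess C Ce) (Be_law : stationary_excess B Be).
Hypothesis copies_indep : mutually_independent P (fun i : 'I_4 =>
  tnth [tuple sigma_rv M00; sigma_rv M01; sigma_rv Ce; sigma_rv Be] i).
Hypothesis Ce_subexp : subexponential (distribution P Ce).

Let psi := ruin_prob P (max_loss N U).
Let psi0 := ruin_prob P (max_loss N0 U0).
Let psi_r := corrected_replace P eps delta theta (max_loss N0 U0) M00 M01 Ce Be.
Let S : probability R R := distribution P Ce.
Let L : probability R R := distribution P Be.

Let delta_gt0 : 0 < delta.
Proof. by rewrite delta_def mulr_gt0//; exact: mean_gt0. Qed.

Let theta_gt0 : 0 < theta.
Proof. by rewrite theta_def mulr_gt0//; exact: mean_gt0. Qed.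

Let ab_lt1 : (1 - eps) * delta + eps * theta < 1.
Proof. by rewrite -rho_def. Qed.

Let eps01 : 0 <= eps <= 1. Proof. by rewrite eps_ge0. Qed.

Let psi_sol : renewal_sol L S ((1 - eps) * delta) (eps * theta) psi.
Proof.
by have [] := risk_model_renewal lambda_gt0 eps01 B_ge0 C_ge0 B_mean C_mean
  delta_def theta_def ab_lt1 Be_law Ce_law model.
Qed.

Let ab0_lt1 : (1 - 0) * delta + 0 * theta < 1.
Proof. by rewrite subr0 mul1r mul0r addr0. Qed.

Let zero01 : 0 <= (0 : R) <= 1. Proof. by rewrite lexx ler01. Qed.

Let base_renewal :
  renewal_sol L S ((1 - 0) * delta) (0 * theta) psi0 /\
  forall u : R, measurable [set w | (u%:E < max_loss N0 U0 w)%E].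
Proof.
exact: (risk_model_renewal lambda_gt0 zero01 B_ge0 C_ge0 B_mean C_mean
  delta_def theta_def ab0_lt1 Be_law Ce_law base_model).
Qed.

Let psi0_sol : renewal_sol L S ((1 - 0) * delta) (0 * theta) psi0.
Proof. by case: base_renewal. Qed.

Let L0 : L [set x | x < 0] = 0%E. Proof. exact: excess_lt0 B_mean Be_law. Qed.

Let LS : survival L u / survival S u @[u --> +oo] --> (0 : R).
Proof.
have [h h0 hB] := phase_type_tail B_phase_type.
exact: (excess_ratio0 B_mean Be_law h0 hB Ce_subexp).
Qed.

Let psi_ratio : psi u / survival S u @[u --> +oo] --> eps * theta / (1 - rho).
Proof.
have [a0 b0] := load_ge0 lambda_gt0 eps01 B_mean C_mean delta_def theta_def.
rewrite rho_def.
exact: (renewal_sol_ratio a0 b0 ab_lt1 Ce_subexp L0 LS psi_sol).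
Qed.

Let psi0_ratio : psi0 u / survival S u @[u --> +oo] --> (0 : R).
Proof.
have [a0 b0] := load_ge0 lambda_gt0 zero01 B_mean C_mean delta_def theta_def.
have := renewal_sol_ratio a0 b0 ab0_lt1 Ce_subexp L0 LS psi0_sol.
by rewrite !mul0r.
Qed.

Let psi0_cvg0 : psi0 u @[u --> +oo] --> (0 : R).
Proof.
rewrite -(mulr0 0); apply: cvg_trans (cvgM psi0_ratio (@survival_cvg0 _ S)).
apply: near_eq_cvg; near=> u => /=.
by rewrite divfK// gt_eqF// subexp_tail_gt0.
Unshelve. all: by end_near. Qed.

Let psi0_unit : unit_fun psi0. Proof. by case: psi0_sol. Qed.

Let copy_tail (M : {RV P >-> \bar R}) : same_law P P M (max_loss N0 U0) ->
  forall u, fine (P [set w | (u%:E < M w)%E]) = psi0 u.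
Proof. by move=> law u; rewrite /psi0 /ruin_prob -(law _ (measurable_egt u)). Qed.

Let psi0_lt0 u : u < 0 -> psi0 u = 1. Proof. by case: psi0_unit => _ _; apply. Qed.

Let survival_copy (M : {RV P >-> \bar R}) : same_law P P M (max_loss N0 U0) ->
  survival (distribution P (fineRV M)) = psi0.
Proof.
by move=> law; exact: (survival_fineRV (copy_tail law) psi0_cvg0 psi0_lt0).
Qed.

Let m1 : probability R R := distribution P (fineRV M01).

Let sum_tail (V : {RV P >-> R}) (u : R) :
  (forall A1 A2 A3, measurable A1 -> measurable A2 -> measurable A3 ->
    P (fineRV M00 @^-1` A1 `&` fineRV M01 @^-1` A2 `&` V @^-1` A3) =
    (P (fineRV M00 @^-1` A1) * P (fineRV M01 @^-1` A2) * P (V @^-1` A3))%E) ->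
  fine (P [set w | (u%:E < M00 w + M01 w + (V w)%:E)%E]) =
  convolve (distribution P V) (convolve m1 psi0) u.
Proof.
move=> ind; have := indep3_sum_tail u ind; rewrite (survival_copy M00_law) => <-.
congr fine.
have mf (M : {RV P >-> \bar R}) : measurable_fun setT M by [].
have mV : measurable_fun setT V by [].
apply: (probability_eq_off_null
  (Z := [set w | M00 w \isn't a fin_num] `|` [set w | M01 w \isn't a fin_num])).
- have ms : measurable_fun setT (fun w => M00 w + M01 w + (V w)%:E)%E.
    apply: emeasurable_funD; first exact: emeasurable_funD.
    exact/measurable_EFinP.
  exact: (measurable_preimage ms (measurable_egt u)).
- have ms : measurable_fun setT (fun w => fineRV M00 w + fineRV M01 w + V w).
    by apply: measurable_funD => //; exact: measurable_funD.
  exact: (measurable_preimage ms (measurable_ray_gt u)).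
- by apply: measurableU; exact: measurable_nonfin.
- apply/eqP; rewrite eq_le measure_ge0 andbT.
  apply: le_trans (measureU2 _ _ _) _; try exact: measurable_nonfin.
  rewrite [X in (X + _ <= _)%E](_ : _ = 0%E); last first.
    exact: (nonfin0 (copy_tail M00_law) psi0_cvg0 psi0_lt0).
  rewrite [X in (_ + X <= _)%E](_ : _ = 0%E) ?adde0//.
  exact: (nonfin0 (copy_tail M01_law) psi0_cvg0 psi0_lt0).
move=> w /= /not_orP[/negP + /negP]; rewrite !negbK => f0 f1.
by rewrite -(fineK f0) -(fineK f1) -!EFinD lte_fin.
Qed.

Let sum_Ce u : fine (P [set w | (u%:E < M00 w + M01 w + (Ce w)%:E)%E]) =
  convolve S (convolve m1 psi0) u.
Proof.
apply: sum_tail => A1 A2 A3 mA1 mA2 mA3.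
apply: (@mutually_independent3 _ _ _ P _ _ (@Ordinal 4 0 isT) (@Ordinal 4 1 isT)
  (@Ordinal 4 2 isT) _ _ _ copies_indep) => //.
- exact: sigma_rv_fine.
- exact: sigma_rv_fine.
- exact: sigma_rv_preimage.
Qed.

Let sum_Be u : fine (P [set w | (u%:E < M00 w + M01 w + (Be w)%:E)%E]) =
  convolve L (convolve m1 psi0) u.
Proof.
apply: sum_tail => A1 A2 A3 mA1 mA2 mA3.
apply: (@mutually_independent3 _ _ _ P _ _ (@Ordinal 4 0 isT) (@Ordinal 4 1 isT)
  (@Ordinal 4 3 isT) _ _ _ copies_indep) => //.
- exact: sigma_rv_fine.
- exact: sigma_rv_fine.
- exact: sigma_rv_preimage.
Qed.

Let psi_rE u : psi_r u = psi0 u +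
  eps * theta / (1 - delta) * (convolve S (convolve m1 psi0) u - psi0 u) -
  eps * delta / (1 - delta) * (convolve L (convolve m1 psi0) u - psi0 u).
Proof.
by rewrite /psi_r /corrected_replace sum_Ce sum_Be !(copy_tail M00_law).
Qed.

Let m1_lt0 : m1 [set x | x < 0] = 0%E.
Proof.
by apply: survival_eq1_lt0 => u; rewrite (survival_copy M01_law); exact: psi0_lt0.
Qed.

(** The sum M00 + M01 has a negligible tail; adding C^e gives a tail equivalent to that of S, adding
    B^e a negligible one. *)
Let psi_r_ratio : psi_r u / survival S u @[u --> +oo] --> eps * theta / (1 - delta).
Proof.
have [mp0 p01 pn] := psi0_unit.
have m1S : survival m1 u / survival S u @[u --> +oo] --> (0 : R).
  by rewrite (survival_copy M01_law).
have g := conv_ratio Ce_subexp m1_lt0 m1S mp0 p01 pn psi0_ratio.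
have [mg g01 gn] := unit_fun_conv m1_lt0 psi0_unit.
have gS := conv_ratio Ce_subexp (subexp_lt0 Ce_subexp)
  (survival_ratio_self Ce_subexp) mg g01 gn g.
have gL := conv_ratio Ce_subexp L0 LS mg g01 gn g.
have -> : eps * theta / (1 - delta) = 0 +
   eps * theta / (1 - delta) * (0 + 0 + 1 - 0) -
   eps * delta / (1 - delta) * (0 + 0 + 0 - 0) by ring.
apply: cvg_trans (cvgB (cvgD psi0_ratio
  (cvgM (cvg_cst (eps * theta / (1 - delta))) (cvgB gS psi0_ratio)))
  (cvgM (cvg_cst (eps * delta / (1 - delta))) (cvgB gL psi0_ratio))).
by apply: near_eq_cvg; near=> u; rewrite /= psi_rE !fctE/=; ring.
Unshelve. all: by end_near. Qed.

Lemma relative_error_cvg : `|1 - psi_r u / psi u| @[u --> +oo] -->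
  (`|eps * (theta - delta) / (1 - delta)| : R).
Proof.
have d1 : 1 - delta != 0 by rewrite gt_eqF// subr_gt0.
(* At eps = 0 the limit of psi / survival S is 0 and cannot be inverted; there psi and psi_0 solve
   the same renewal equation. *)
move: eps_ge0; rewrite le_eqVlt => /predU1P[eps0|eps_gt0].
  have psiE : psi =1 psi0.
    apply: renewal_sol_unique psi0_sol.
    - by rewrite subr0 mul1r ltW.
    - by rewrite mul0r.
    - exact: ab0_lt1.
    - by have := psi_sol; rewrite -eps0.
  rewrite -eps0 !mul0r normr0.
  apply: (@cvg_trans _ ((fun=> 0 : R) @ +oo)); last exact: cvg_cst.
  apply: near_eq_cvg; near=> u.
  rewrite psi_rE -eps0 !mul0r subr0 addr0 psiE divff ?subrr ?normr0//.
  rewrite gt_eqF//; apply: (renewal_sol_gt0 u _ _ _ _ psi0_sol).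
  - by rewrite subr0 mul1r.
  - by rewrite mul0r.
  - by rewrite subr0 mul1r ltW.
  - exact: excess_tail0 B_mean Be_law.
have r1 : 1 - rho != 0 by rewrite gt_eqF// subr_gt0.
have lim_ne0 : eps * theta / (1 - rho) != 0.
  by rewrite gt_eqF// divr_gt0 ?mulr_gt0// subr_gt0.
(* The two constants have quotient (1 - rho) / (1 - delta), and rho - delta = eps (theta -
   delta). *)
have -> : eps * (theta - delta) / (1 - delta) =
    1 - (eps * theta / (1 - delta)) / (eps * theta / (1 - rho)).
  rewrite rho_def in r1 *; field.
  by rewrite d1 r1 !gt_eqF.
apply: cvg_norm; apply: cvgB; first exact: cvg_cst.
apply: cvg_trans (cvgM psi_r_ratio (cvgV lim_ne0 psi_ratio)).
apply: near_eq_cvg; near=> u => /=.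
have s0 : survival S u != 0 by rewrite gt_eqF// subexp_tail_gt0.
by rewrite invf_div mulrA divfK.
Unshelve. all: by end_near. Qed.

End main.

Theorem lemma2 (R : realType) (d : measure_display) (T : measurableType d)
  (P : probability T R) (lambda eps delta theta rho : R)
  (B C : {RV P >-> R})
  (N N0 : R -> T -> nat) (U U0 : nat -> {RV P >-> R})
  (M00 M01 : {RV P >-> \bar R}) (Ce Be : {RV P >-> R})
  (lambda_gt0 : 0 < lambda) (eps_ge0 : 0 <= eps) (eps_le1 : eps <= 1)
  (B_ge0 : forall w, 0 <= B w) (C_ge0 : forall w, 0 <= C w)
  (B_phase_type : phase_type P B) (C_heavy : heavy_tailed P C)
  (B_mean : (0 < 'E_P[B] < +oo)%E) (C_mean : (0 < 'E_P[C] < +oo)%E)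
  (delta_def : delta = lambda * fine ('E_P[B])%E)
  (theta_def : theta = lambda * fine ('E_P[C])%E)
  (rho_def : rho = (1 - eps) * delta + eps * theta)
  (rho_lt1 : rho < 1) (delta_lt1 : delta < 1)
  (model : risk_model lambda eps B C N U)
  (base_model : risk_model lambda 0 B C N0 U0)
  (M00_law : same_law P P M00 (max_loss N0 U0))
  (M01_law : same_law P P M01 (max_loss N0 U0))
  (Ce_law : stationary_excess C Ce) (Be_law : stationary_excess B Be)
  (copies_indep : mutually_independent P (fun i : 'I_4 =>
     tnth [tuple sigma_rv M00; sigma_rv M01; sigma_rv Ce; sigma_rv Be] i))
  (Ce_subexp : subexponential (distribution P Ce)) :
  let psi := ruin_prob P (max_loss N U) in
  let psi_r :=
    corrected_replace P eps delta theta (max_loss N0 U0) M00 M01 Ce Be in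
  (`|1 - psi_r u / psi u| @[u --> +oo] -->
     (`|eps * (theta - delta) / (1 - delta)| : R)) /\
  (('E_P[B] = 'E_P[C])%E -> `|1 - psi_r u / psi u| @[u --> +oo] --> (0 : R)).
Proof.
move=> psi psi_r.
have lim : `|1 - psi_r u / psi u| @[u --> +oo] -->
    (`|eps * (theta - delta) / (1 - delta)| : R).
  exact: (relative_error_cvg lambda_gt0 eps_ge0 eps_le1 B_ge0 C_ge0 B_phase_type
    B_mean C_mean delta_def theta_def rho_def rho_lt1 delta_lt1 model base_model
    M00_law M01_law Ce_law Be_law copies_indep Ce_subexp).
split=> // BC; move: lim.
by rewrite theta_def delta_def BC subrr mulr0 mul0r normr0.
Qed.
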